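(* There exist $d\in\mathbb N$ and two disjoint FLC sets $\Lambda_1,\Lambda_2\subset\mathbb R^d$ with the following properties: (a) $\Lambda_1$ and $\Lambda_1\cup\Lambda_2$ are MLD equivalent; (b) the point process associated to $\Lambda_1$ is not hyperuniform; (c) the point process associated to $\Lambda_1\cup\Lambda_2$ is hyperuniform.
   Context: A locally finite set $\Lambda\subset\mathbb R^d$ is an FLC set (has finite local complexity) if for every compact $K\subset\mathbb R^d$ the family $\{(\Lambda-x)\cap K: x\in\Lambda\}$ is finite. A set $\Lambda'\subset\mathbb R^d$ is locally derivable from $\Lambda\subset\mathbb R^d$ if there is a compact $K\subset\mathbb R^d$ such that, for all $x,y\in\mathbb R^d$, $(\Lambda-x)\cap K=(\Lambda-y)\cap K$ implies $(\Lambda'-x)\cap\{0\}=(\Lambda'-y)\cap\{0\}$. Two sets are MLD (mutually locally derivable) equivalent if each is locally derivable from the other. For a locally finite set $\Lambda$, its hull $\Omega_\Lambda$ is the closure of $\{\Lambda+x: x\in\mathbb R^d\}$ in the Chabauty--Fell topology on closed subsets of $\mathbb R^d$. The point process associated to $\Lambda$ is the stationary point process given by a random element of $\Omega_\Lambda$ distributed according to the unique translation-invariant Borel probability measure on $\Omega_\Lambda$; when one speaks of it, it is understood (as part of the assertion) that $\Omega_\Lambda$ is uniquely ergodic. A stationary locally square-integrable point process $\Phi$ on $\mathbb R^d$ is hyperuniform if $\lim_{R\to\infty}\operatorname{Var}(\#(\Phi\cap B_R))/R^d=0$, where $B_R$ is the closed Euclidean ball of radius $R$ centered at $0$. *)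

(* Defs.v *)
From HB Require Import structures.
From mathcomp Require Import all_boot all_order all_algebra.
From mathcomp Require Import all_classical all_reals all_analysis.

Set Implicit Arguments.
Unset Strict Implicit.
Unset Printing Implicit Defensive.

Import Order.TTheory GRing.Theory Num.Theory.
Import numFieldNormedType.Exports.

Local Open Scope classical_set_scope.
Local Open Scope ring_scope.

Section PointSets.
Context {R : realType} {d : nat}.
Implicit Types (L K A : set 'rV[R]_d) (x y : 'rV[R]_d).

Definition translate x A : set 'rV[R]_d := [set y + x | y in A].

Definition locally_finite L := forall K, compact K -> finite_set (L `&` K).

Definition FLC L :=
  locally_finite L /\
  forall K, compact K -> finite_set [set translate (- x) L `&` K | x in L].

Definition locally_derivable_from L' L :=
  exists2 K, compact K & forall x y,
    translate (- x) L `&` K = translate (- y) L `&` K ->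
    translate (- x) L' `&` [set 0] = translate (- y) L' `&` [set 0].

Definition MLD_equivalent L L' :=
  locally_derivable_from L L' /\ locally_derivable_from L' L.

(* The library norm on 'rV[R]_d is the sup norm (it induces the same
   topology), so the Euclidean one is spelled out. *)
Definition euclidean_ball (r : R) : set 'rV[R]_d :=
  [set x | Num.sqrt (\sum_(i < d) x ord0 i ^+ 2) <= r].

Lemma closed_translate x A : closed A -> closed (translate x A).
Proof.
move=> cA; have -> : translate x A = (fun y => y - x) @^-1` A.
  apply/seteqP; split=> [_ [y Ay <-]|y Ay] /=; first by rewrite addrK.
  by exists (y - x); rewrite ?subrK.
apply: preimage_closed => // y _.
exact: (@cvgB _ _ _ (nbhs y) _ id (cst x) y x cvg_id (cvg_cst _)).
Qed.

End PointSets.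

(* A record rather than a sigma-type over [set 'rV[R]_d], so that the only
   topology found on it is the Fell topology declared below. *)
Record closed_set (R : realType) (d : nat) := ClosedSet {
  carrier :> set 'rV[R]_d;
  closed_carrier : closed carrier }.

HB.instance Definition _ (R : realType) (d : nat) :=
  gen_eqMixin (closed_set R d).
HB.instance Definition _ (R : realType) (d : nat) :=
  gen_choiceMixin (closed_set R d).
HB.instance Definition _ (R : realType) (d : nat) :=
  isPointed.Build (closed_set R d) (ClosedSet closed0).

Definition fell_subbase (R : realType) (d : nat) : set (set (closed_set R d)) :=
  [set [set F : closed_set R d | F `&` K = set0] | K in @compact 'rV[R]_d]
  `|` [set [set F : closed_set R d | F `&` U !=set0] | U in @open 'rV[R]_d].

HB.instance Definition _ (R : realType) (d : nat) :=
  @isSubBaseTopological.Build (closed_set R d) (set (closed_set R d))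
    (@fell_subbase R d) id.

Definition fell_borel (R : realType) (d : nat) :=
  g_sigma_algebraType (@open (closed_set R d)).

(* The law of a random closed set; local finiteness of the random set is
   not built in. *)
Definition point_process_law (R : realType) (d : nat) :=
  probability (fell_borel R d) R.

Section PointProcesses.
Context {R : realType} {d : nat}.
Implicit Types (L : set 'rV[R]_d) (P Q : point_process_law R d).

Definition closed_set_translate (x : 'rV[R]_d) (F : closed_set R d) :
    closed_set R d :=
  ClosedSet (closed_translate (x := x) (closed_carrier (c := F))).

(* When L is closed (in particular locally finite), every translate of L is
   the carrier of exactly one element of the set under [closure]. *)
Definition hull L : set (closed_set R d) :=
  closure [set F : closed_set R d | exists x, F = translate x L :> set 'rV[R]_d].

Definition stationary P :=
  forall x (A : set (fell_borel R d)), measurable A ->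
    P (closed_set_translate x @^-1` A) = P A.

(* Borel probability measures on the closed set [hull L] are identified with
   Borel probability measures on the whole space giving it mass 1. *)
Definition invariant_on_hull L P := P (hull L) = 1%E /\ stationary P.

(* The second clause is unique ergodicity of the hull; measures are compared
   on Borel sets only since their values elsewhere carry no information. *)
Definition associated_point_process L P :=
  invariant_on_hull L P /\
  forall Q, invariant_on_hull L Q ->
    forall A : set (fell_borel R d), measurable A -> Q A = P A.

(* [counting] is +oo on infinite sets, hence this forces P-almost every
   configuration to be locally finite. *)
Definition locally_square_integrable P :=
  forall K : set 'rV[R]_d, compact K ->
    (\int[P]_F (counting (carrier F `&` K) ^+ 2) < +oo)%E.

(* Junk value 0 when F has infinitely many points in the ball. *)
Definition ball_count (r : R) (F : fell_borel R d) : R :=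
  fine (counting (carrier F `&` euclidean_ball r)).

Definition hyperuniform P :=
  ('V_P[ball_count r] * (r ^- d)%:E)%E @[r --> +oo%R] --> (0 : \bar R)%E.

End PointProcesses.

(* Main.v *)
From HB Require Import structures.
Require Import Defs.
From mathcomp Require Import all_boot all_order all_algebra.
From mathcomp Require Import all_classical all_reals all_analysis.
From mathcomp Require Import measurable_realfun.
From mathcomp Require Import zify ring lra.

(** The dimension is one. Fix an angle [a] and code each integer [k] by whether [- k a] falls
    in the half circle [0, 1/2) modulo 1. The first set consists of the integers coded true,
    the second of the points [k + 1/4] with [k] coded false.

    The union has exactly one point in each cell [k, k + 1), so the number of its points in an
    interval is the length up to a bounded error ([ball_count_union]): its variance is bounded
    and it is hyperuniform ([union_hyperuniform]). When [1/4 <= a <= 1/2] the code has no run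
    of length three ([window_runs]), so the first set and the union both show, within bounded
    distance, where the cells are and how they are coded: they are mutually locally derivable
    ([seed_MLD]).

    The first set counts the visits of an orbit of the rotation by [a] to a half circle, and
    these sums fluctuate as much as one likes when [a] is well approximable. Let [p / q] be
    extremely close to [a] with [q] odd. For most starting angles an orbit of length [q ^ 2]
    follows the rational orbit ([shadowing_angles]), which meets the window [m] times in every
    [q] steps; moving the start by [1 / (2 q)] replaces [m] by [q - m], and [m] differs from
    [q - m] because [q] is odd. The two sums differ by at least [q] ([long_sum_jump]), so the
    variance over an interval of length [q ^ 2] is at least of order [q ^ 2] ([orbit_sum_variance]), and
    the first set is not hyperuniform ([seed_not_hyperuniform]). Liouville numbers provide such
    angles ([exists_liouville]).

    Both hulls are treated at once by a boolean [b], false for the first set and true for the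
    union. A configuration [conf b a t th] has a phase [t], the position of the cells, and an
    angle [th], the start of the orbit; a unit translation turns the angle by [a] ([confD1]).
    With phase and angle uniform this gives a stationary law ([law_stationary]). It lives on
    the hull because the window is half-open: every angle is approached from the right by
    the orbit, with the same code in any bounded region ([conf_in_hull]).

    For uniqueness, the law of a random closed set is determined by the probabilities of
    missing finite unions of dyadic cells ([fell_borel_void]). Whether a configuration misses
    such a union depends on the dyadic part of the phase and on finitely many window values, so
    its frequency over one period of the phase and [q] steps of the rotation is the same for
    all configurations, up to [O(1 / q)] ([avoid_count_uniform]). Such a bound along the orbit
    of one point set carries over to open events on its hull ([open_frequency]); applied to an
    event and to its complement, it pins down the probability under every invariant law
    ([void_probability], [uniquely_ergodic]). *)

Set Implicit Arguments.
Unset Strict Implicit.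
Unset Printing Implicit Defensive.

Import Order.TTheory GRing.Theory Num.Theory.
Import numFieldNormedType.Exports.

Local Open Scope classical_set_scope.
Local Open Scope ring_scope.

(** * Orbits of a rotation and the half-circle window *)

Section Rotation.
Context {R : realType}.
Implicit Types (x y z c a th : R).

(** The half circle [0, 1/2) modulo 1, written as a parity so that its periodicity and its
    behaviour under a half turn are read off the floor. *)
Definition window y : bool := (2 %| Num.floor (2 * y))%Z.

Lemma floorDz y (k : int) : Num.floor (y + k%:~R) = Num.floor y + k.
Proof. by rewrite floorDrz ?intrKfloor ?rpred_int. Qed.

Lemma windowDz y (k : int) : window (y + k%:~R) = window y.
Proof.
rewrite /window.
have -> : 2 * (y + k%:~R) = 2 * y + (2 * k)%:~R :> R by rewrite intrM; ring.
by rewrite floorDz; lia.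
Qed.

Lemma windowDhalf y : window (y + 2^-1) = ~~ window y.
Proof.
rewrite /window.
have -> : 2 * (y + 2^-1) = 2 * y + 1%:~R :> R by field.
by rewrite floorDz; lia.
Qed.

Lemma window_itv y : 0 <= y < 2^-1 -> window y.
Proof.
move=> /andP[y0 y1]; rewrite /window (@floor_def _ _ 0)//.
by apply/andP; split; lra.
Qed.

Lemma nwindow_itv y : 2^-1 <= y < 1 -> ~~ window y.
Proof.
move=> /andP[y0 y1]; rewrite /window (@floor_def _ _ 1)//.
by apply/andP; split; rewrite /=; lra.
Qed.

Lemma floor_eq_window y z :
  Num.floor (2 * y) = Num.floor (2 * z) -> window y = window z.
Proof. by rewrite /window => ->. Qed.

Lemma residue_perm (q : nat) (p e : int) : (0 < q)%N -> coprimez p q ->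
  exists2 s : 'I_q -> 'I_q, injective s &
    forall n : 'I_q, (s n)%:Z = ((n%:Z * p + e) %% q)%Z.
Proof.
move=> q0 cpq.
have sP (n : 'I_q) : (`|((n%:Z * p + e) %% q)%Z| < q)%N by lia.
pose s n := Ordinal (sP n).
have sE n : (s n)%:Z = ((n%:Z * p + e) %% q)%Z by rewrite /s /=; lia.
exists s => // m n /(congr1 (fun i : 'I_q => i%:Z)); rewrite !sE => /eqP.
rewrite eqz_mod_dvd.
have -> : m%:Z * p + e - (n%:Z * p + e) = (m%:Z - n%:Z) * p by ring.
rewrite Gauss_dvdzl; last by rewrite coprimez_sym.
rewrite -eqz_mod_dvd => /eqP; rewrite !modz_small ?ltz_nat ?ltn_ord//.
by move=> [?]; exact: val_inj.
Qed.

Lemma sum_residues (V : nmodType) (q : nat) (p e : int) (f : int -> V) :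
  (0 < q)%N -> coprimez p q -> (forall i k : int, f (i + k * q) = f i) ->
  \sum_(n < q) f (n%:Z * p + e) = \sum_(i < q) f i%:Z.
Proof.
move=> q0 cpq fper; have [s sI sE] := residue_perm e q0 cpq.
rewrite [RHS](reindex_inj sI) /=; apply: eq_bigr => n _; rewrite sE.
rewrite -[RHS](fper _ ((n%:Z * p + e) %/ q)%Z); congr f.
by rewrite [LHS](divz_eq _ q) addrC.
Qed.

(** The sum telescopes: each term is [g (i + 2) - g i] for a sequence with
    [g (i + q) = g i + 2]. *)
Lemma sum_floor_gap (q : nat) c : (0 < q)%N ->
  \sum_(i < q) (Num.floor (2 * (i%:R / q%:R + c) + 4 / q%:R) -
    Num.floor (2 * (i%:R / q%:R + c))) = 4.
Proof.
move=> q0; have q0' : q%:R != 0 :> R by rewrite pnatr_eq0; lia.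
pose g (n : nat) := Num.floor (2 * (n%:R / q%:R + c)).
have gq n : g (n + q)%N = g n + 2.
  rewrite /g -floorDz; congr Num.floor; rewrite natrD; field.
  by [].
rewrite (eq_bigr (fun i : 'I_q => g i.+2 - g i)); last first.
  move=> i _; rewrite /g; congr (Num.floor _ - _).
  by rewrite -[i.+2]addn2 natrD; field.
have -> : \sum_(i < q) (g i.+2 - g i) =
   \sum_(i < q) (g i.+2 - g i.+1) + \sum_(i < q) (g i.+1 - g i).
  by rewrite -big_split; apply: eq_bigr => i _ /=; ring.
rewrite -!(big_mkord xpredT (fun i => g i.+1 - g i)).
rewrite -(big_mkord xpredT (fun i => g i.+2 - g i.+1)).
rewrite (telescope_sumr (fun i => g i.+1))// telescope_sumr//.
by have := gq 0%N; have := gq 1%N; rewrite add0n add1n; lia.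
Qed.

(** A change of window value between [y] and [y + r] forces the floor to grow in between; the
    growth, unlike the change, telescopes. *)
Lemma neq_window_le y r r' : 0 <= r <= r' ->
  (window (y + r) != window y)%:Z <= Num.floor (2 * y + 2 * r') - Num.floor (2 * y).
Proof.
move=> /andP[r0 rr'].
have le1 : Num.floor (2 * y) <= Num.floor (2 * (y + r)) by apply: le_floor; lra.
have le2 : Num.floor (2 * (y + r)) <= Num.floor (2 * y + 2 * r').
  by apply: le_floor; lra.
case: eqP => /= [_|]; first lia.
by rewrite /window; lia.
Qed.

(** [p / q] approximates [a] from below so well that in [q] steps the rotation by [a] drifts
    away from the rotation by [p / q] by at most [1 / q]. *)
Definition approximant a (q : nat) (p : int) :=
  [/\ (0 < q)%N, coprimez p q, 0 <= a - p%:~R / q%:R & (a - p%:~R / q%:R) * q%:R ^+ 2 <= 1].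

Lemma approximant_drift a q p (n : nat) : approximant a q p -> (n <= q)%N ->
  0 <= n%:R * (a - p%:~R / q%:R) <= q%:R^-1.
Proof.
move=> [q0 _ d0 dq] nq; rewrite mulr_ge0//=.
have q0' : 0 < q%:R :> R by rewrite ltr0n.
rewrite -[leRHS]mul1r ler_pdivlMr//.
apply: le_trans dq; rewrite expr2 mulrA ler_wpM2r ?ler0n//.
by rewrite mulrC ler_wpM2l// ler_nat.
Qed.

(** Modulo 1 the orbit point of index [n] lies in [[s n / q, s n / q + 2 / q)]. A disagreement of
    the window values therefore forces a growth of the floor, and the growths add up to 4. *)
Lemma orbit_shadow a q p th : approximant a q p ->
  exists2 s : 'I_q -> 'I_q, injective s & forall c,
    (\sum_(n < q) (window (th + n%:R * a + c)%R != window ((s n)%:R / q%:R + c)%R) <= 4)%N.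
Proof.
move=> apq; have [q0 cpq d0 dq] := apq.
have q0' : 0 < q%:R :> R by rewrite ltr0n.
have qn0 : q%:R != 0 :> R by rewrite gt_eqF.
set e := Num.floor (q%:R * th); set d := a - _ in d0 dq.
pose r := th - e%:~R / q%:R.
have r01 : 0 <= r < q%:R^-1.
  have /andP[e1 e2] := floor_itv (q%:R * th); rewrite -/e in e1 e2.
  rewrite /r subr_ge0 ler_pdivrMr// mulrC e1/=.
  by rewrite ltrBlDr -[X in _ < X + _]div1r -mulrDl ltr_pdivlMr// mulrC addrC -[1]/1%:~R -intrD.
have [s sI sE] := residue_perm e q0 cpq.
exists s => // c.
rewrite -lez_nat -[leRHS]/(4 : int) -(sum_floor_gap c q0).
rewrite [leRHS](reindex_inj sI) /= -natz natr_sum.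
apply: ler_sum => n _; rewrite natz.
set z := (s n)%:R / q%:R + c.
have -> : th + n%:R * a + c =
    z + (r + n%:R * d) + ((n%:Z * p + e) %/ q)%Z%:~R.
  have /(congr1 (fun k : int => k%:~R : R)) := divz_eq (n%:Z * p + e) q.
  rewrite -sE !intrD !intrM -!pmulrn => E.
  have Es : (s n)%:R = n%:R * p%:~R + e%:~R - ((n%:Z * p + e) %/ q)%Z%:~R * q%:R :> R.
    by rewrite E; ring.
  by rewrite /z Es /r /d; field.
rewrite windowDz.
have -> : 4 / q%:R = 2 * (2 / q%:R) :> R by field.
apply: neq_window_le.
have /andP[u1 u2] := approximant_drift apq (ltnW (ltn_ord n)).
rewrite -/d in u1 u2; case/andP: r01 => r0 r1.
rewrite addr_ge0//=.
have -> : 2 / q%:R = q%:R^-1 + q%:R^-1 :> R by field.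
by rewrite lerD// ltW.
Qed.

(** The source of unique ergodicity: for a boolean [H] read off finitely many window values, the
    count along [q] steps depends on the starting angle by an amount that does not grow
    with [q]. *)
Lemma orbit_frequency a q p (cs : seq R) (H : R -> bool) th :
  approximant a q p ->
  (forall x y, all (fun c => window (x + c) == window (y + c)) cs -> H x = H y) ->
  `|(\sum_(n < q) H (th + n%:R * a)%R)%N%:Z - (\sum_(i < q) H (i%:R / q%:R)%R)%N%:Z| <= (4 * size cs)%N%:Z.
Proof.
move=> apq Hcs; have [s sI sP] := orbit_shadow th apq.
rewrite [X in _ - X%:Z](reindex_inj sI) /= -!natz !natr_sum -sumrB.
apply: le_trans (ler_norm_sum _ _ _) _.
apply: (@le_trans _ _ (\sum_(n < q) \sum_(c <- cs)
   (window (th + n%:R * a + c) != window ((s n)%:R / q%:R + c))%:Z)).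
  apply: ler_sum => n _; rewrite !natz.
  have [E|/allPn[c ccs cP]] := boolP (all (fun c => window (th + n%:R * a + c) ==
    window ((s n)%:R / q%:R + c)) cs).
    by rewrite (Hcs _ _ E) subrr normr0 sumr_ge0.
  rewrite (big_rem c)//= cP ler_wpDr ?sumr_ge0//.
  by case: (H _); case: (H _).
rewrite exchange_big /= natz.
have -> : (4 * size cs)%N%:Z = \sum_(c <- cs) 4 :> int.
  by rewrite big_const_seq count_predT iter_addr_0; lia.
apply: ler_sum => c _; under eq_bigr do rewrite -natz.
by rewrite -natr_sum natz lez_nat.
Qed.

End Rotation.

(** * Liouville angles *)

Section Liouville.
Context {R : realType}.
Implicit Types (x y z c a th e : R).

(** The density is one-sided because the window is stable under small moves to the right only.
    The witness is the orbit point that shadows the first multiple of [1 / q] after [th]. *)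
Lemma orbit_right_dense a th e :
  (forall Q : nat, exists2 q : nat, (Q <= q)%N & exists p, approximant a q p) ->
  0 < e -> exists (n : nat) (k : int), th <= n%:R * a + k%:~R < th + e.
Proof.
move=> appr e0.
have [q Qq [p apq]] := appr (Num.truncn (2 / e)).+1.
have [q0 cpq d0 dq] := apq.
have q0' : 0 < q%:R :> R by rewrite ltr0n.
have qe : 2 / q%:R < e.
  rewrite ltr_pdivrMr// mulrC -ltr_pdivrMr//.
  apply: lt_le_trans (truncnS_gt _) _; first by rewrite ler_nat.
have [s sI sE] := residue_perm 0 q0 cpq.
set m := Num.ceil (q%:R * th).
have [n nE] : exists n, (s n)%:Z = (m %% q)%Z.
  have mP : (`|(m %% q)%Z| < q)%N by lia.
  have [t _ tK] := injF_bij sI; exists (t (Ordinal mP)); rewrite tK /=; lia.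
rewrite sE addr0 in nE.
have /(congr1 (fun k : int => k%:~R : R)) E1 := divz_eq (n%:Z * p) q.
have /(congr1 (fun k : int => k%:~R : R)) E2 := divz_eq m q.
move: (m %% q)%Z nE E1 E2 => r ->; rewrite !intrD !intrM -!pmulrn => E1 E2.
have /andP[u1 u2] := approximant_drift apq (ltnW (ltn_ord n)).
pose k := ((m %/ q)%Z - ((n%:Z * p) %/ q)%Z); exists n, k.
have -> : n%:R * a + k%:~R =
   m%:~R / q%:R + n%:R * (a - p%:~R / q%:R).
  rewrite /k intrB.
  have -> : m%:~R / q%:R = (m %/ q)%Z%:~R + r%:~R / q%:R :> R.
    by rewrite E2; field; rewrite gt_eqF.
  have -> : n%:R * (a - p%:~R / q%:R) = n%:R * a - (n%:R * p%:~R) / q%:R.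
    by field; rewrite gt_eqF.
  rewrite E1; field; by rewrite gt_eqF.
have /andP[m1 m2] := ceil_itv (q%:R * th); rewrite -/m in m1 m2.
have m1' : m%:~R / q%:R < th + q%:R^-1.
  rewrite -[X in _ < _ + X]div1r ltr_pdivrMr// mulrDl divfK ?gt_eqF//.
  by move: m1; rewrite intrB; lra.
have m2' : th <= m%:~R / q%:R by rewrite ler_pdivlMr// mulrC.
have E3 : 2 / q%:R = q%:R^-1 + q%:R^-1 :> R by field; rewrite gt_eqF.
by apply/andP; split; lra.
Qed.

(** The fractions [liouville_num j / liouville_den j] are the partial sums of the inverses of the
    denominators; as each denominator is the fifth power of the previous one, the limit is
    within [2 / q ^ 5] of the fraction with denominator [q]. *)
Fixpoint liouville_den (j : nat) : nat := if j is j'.+1 then (liouville_den j' ^ 5)%N else 3.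
Fixpoint liouville_num (j : nat) : nat := if j is j'.+1 then (liouville_num j' * liouville_den j' ^ 4 + 1)%N else 1.

Lemma liouville_den_ge j : (3 + j <= liouville_den j)%N.
Proof.
elim: j => // j IH /=; apply: leq_trans (_ : (liouville_den j) ^ 2 <= _)%N; first nia.
by rewrite leq_exp2l//; lia.
Qed.

Lemma odd_liouville_den j : odd (liouville_den j).
Proof. by elim: j => // j IH; rewrite /= oddX IH orbT. Qed.

Lemma coprime_liouville j : coprime (liouville_num j) (liouville_den j).
Proof.
case: j => [|j] //=; rewrite coprime_sym coprimeXl//.
by rewrite /coprime expnSr mulnA gcdnMDl gcdn1.
Qed.

(** The fourth power makes the rotations by [a] and by [p / q] agree, for most angles, along
    orbits of length [q ^ 2]. Oddness of [q] is what separates the two visit counts in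
    [long_sum_jump]. *)
Definition liouville_like a := forall Q : nat, exists q p : nat,
   [/\ (Q <= q)%N, odd q, approximant a q p & 8 * q%:R ^+ 4 * (a - p%:R / q%:R) <= 1].

Lemma exists_liouville :
  exists a : R, [/\ 4^-1 <= a, a <= 2^-1 & liouville_like a].
Proof.
pose u j : R := (liouville_num j)%:R / (liouville_den j)%:R.
pose e j : R := (liouville_den j)%:R^-1.
have pow_gt0 j : 0 < (liouville_den j)%:R :> R by rewrite ltr0n; have := liouville_den_ge j; lia.
have uS j : u j.+1 = u j + e j.+1.
  rewrite /u /e /= natrD natrM !natrX; field; rewrite gt_eqF//.
have eS j : 2 * e j.+1 <= e j.
  rewrite /e ler_pdivrMr// mulrC ler_pdivlMr// -natrM ler_nat /=.
  have := liouville_den_ge j; move: (liouville_den j) => x x3.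
  apply: (@leq_trans (x ^ 2)%N); first by rewrite -mulnn leq_mul2r; lia.
  by rewrite leq_pexp2l//; lia.
have e_gt0 j : 0 < e j by rewrite invr_gt0.
have u_le i j : (i <= j)%N -> u i <= u j.
  elim: j => [|j IH]; first by rewrite leqn0 => /eqP ->.
  rewrite leq_eqVlt => /orP[/eqP -> //|/IH ij]; rewrite uS (le_trans ij)//.
  by rewrite lerDl ltW.
have v_le i j : (i <= j)%N -> u j + 2 * e j.+1 <= u i + 2 * e i.+1.
  elim: j => [|j IH]; first by rewrite leqn0 => /eqP ->.
  rewrite leq_eqVlt => /orP[/eqP -> //|/IH ij]; apply: le_trans ij.
  by rewrite uS; have := eS j.+1; lra.
have uv i j : u i <= u j + 2 * e j.+1.
  have := v_le _ _ (leq_maxr i j); have := u_le _ _ (leq_maxl i j).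
  by have := e_gt0 (maxn i j).+1; lra.
pose A := range u.
have uA i : A (u i) by exists i.
have ubA j : ubound A (u j + 2 * e j.+1) by move=> _ [i _ <-].
have supA : has_sup A by split; [exists (u 0); exact: uA | exists (u 0 + 2 * e 1)].
pose a := sup A.
have ua j : u j <= a by apply: ub_le_sup => //; case: supA.
have av j : a <= u j + 2 * e j.+1 by apply: ge_sup => //; case: supA.
exists a; split.
- apply: le_trans (ua 0); rewrite /u /=; lra.
- by apply: le_trans (av 0) _; rewrite /u /e /= natrX; lra.
(* a denominator of at least 16 turns the error 2 / q^5 into 1 / (8 q^4) *)
move=> Q; pose j := maxn 16 Q; exists (liouville_den j), (liouville_num j).
have pj : (16 <= liouville_den j)%N && (Q <= liouville_den j)%N by have := liouville_den_ge j; lia.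
have /andP[p16 pQ] := pj.
have d0 : 0 <= a - u j by rewrite subr_ge0.
have dle : a - u j <= 2 * e j.+1 by rewrite lerBlDl.
have q16 : 16 <= (liouville_den j)%:R :> R by rewrite ler_nat.
have key : 8 * (liouville_den j)%:R ^+ 4 * (a - u j) <= 1.
  apply: (@le_trans _ _ (8 * (liouville_den j)%:R ^+ 4 * (2 * e j.+1))).
    by rewrite ler_wpM2l// mulr_ge0// exprn_ge0// ltW.
  rewrite /e /= natrX mulrA ler_pdivrMr ?exprn_gt0// mul1r exprS.
  have x0 : 0 <= (liouville_den j)%:R ^+ 4 :> R by rewrite exprn_ge0// ltW.
  by rewrite mulrAC ler_wpM2r//; lra.
have q1 : 1 <= (liouville_den j)%:R :> R by lra.
split => //; first exact: odd_liouville_den.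
split; [lia|exact: coprime_liouville|by rewrite -pmulrn|rewrite -pmulrn].
apply: le_trans key; rewrite mulrC ler_wpM2r//.
apply: (@le_trans _ _ ((liouville_den j)%:R ^+ 4)); first by rewrite ler_eXn2l//; lra.
by rewrite ler_peMl// ?exprn_ge0 ?ltW//; lra.
Qed.

Lemma sum_periodic (q L : nat) (f : nat -> nat) : (forall n, f (n + q) = f n)%N ->
  (\sum_(n < q * L) f n = L * \sum_(n < q) f n)%N.
Proof.
move=> fq; elim: L => [|L IH]; first by rewrite muln0 big_ord0.
rewrite mulnS addnC big_split_ord /= IH mulSn addnC; congr addn.
apply: eq_bigr => i _.
by elim: L {IH} => [|L IH]; rewrite ?muln0// mulnS -addnA addnC fq.
Qed.

(** Together the two cosets form the multiples of [1 / (2 q)], which a half turn permutes while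
    complementing the window. *)
Lemma sum_window_half (q : nat) y : (0 < q)%N ->
  (\sum_(i < q) window (y + i%:R / q%:R)%R +
   \sum_(i < q) window (y + (2 * q%:R)^-1 + i%:R / q%:R)%R = q)%N.
Proof.
move=> q0; have qn0 : q%:R != 0 :> R by rewrite pnatr_eq0; lia.
pose g (k : nat) := window (y + k%:R / (2 * q%:R)).
have gq k : g (k + q)%N = ~~ g k.
  rewrite /g -windowDhalf; congr window; rewrite natrD; field.
  by rewrite pnatr_eq0; lia.
transitivity (\sum_(k < q + q) g k)%N.
  have -> : (\sum_(k < q + q) g k = \sum_(i < q) (g (2 * i)%N + g (2 * i)%N.+1))%N.
    rewrite addnn -mul2n; elim: (q) => [|n IH]; first by rewrite muln0 !big_ord0.
    by rewrite mulnS !add2n !big_ord_recr /= IH addnA.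
  rewrite big_split; congr addn; apply: eq_bigr => i _; rewrite /g; congr (nat_of_bool (window _)).
    by rewrite mul2n -addnn natrD; field.
  by rewrite -addn1 mul2n -addnn !natrD; field.
rewrite big_split_ord /= -big_split /= -[RHS]card_ord -sum1_card.
by apply: eq_bigr => i _; rewrite (addnC q i) gq; case: (g i).
Qed.

Definition orbit_sum a N y := (\sum_(n < N) window (y + n%:R * a)%R)%N.

(** Along the rational orbit the sums are [q * b] and [q * b'] with [b + b' = q] odd, hence
    [b != b']. *)
Lemma long_sum_jump a (q : nat) (p : int) y : odd q -> coprimez p q ->
  (forall n : nat, (n < q * q)%N ->
     window (y + n%:R * a) = window (y + n%:R * (p%:~R / q%:R)) /\
     window (y + (2 * q%:R)^-1 + n%:R * a) = window (y + (2 * q%:R)^-1 + n%:R * (p%:~R / q%:R))) ->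
  q%:Z <= `|(orbit_sum a (q * q) y)%:Z - (orbit_sum a (q * q) (y + (2 * q%:R)^-1))%:Z|.
Proof.
move=> oq cpq good; pose T := orbit_sum a (q * q).
have q0 : (0 < q)%N by case: q oq {cpq good T}.
have qn0 : q%:R != 0 :> R by rewrite pnatr_eq0; lia.
have TE z : (forall n : nat, (n < q * q)%N ->
     window (z + n%:R * a) = window (z + n%:R * (p%:~R / q%:R))) ->
  T z = (q * \sum_(i < q) window (z + i%:R / q%:R)%R)%N.
  move=> gz; rewrite /T /orbit_sum.
  under eq_bigr => n _ do rewrite (gz n (ltn_ord n)).
  rewrite (@sum_periodic q q (fun n => window (z + n%:R * (p%:~R / q%:R)))); last first.
    move=> n; rewrite -(windowDz (z + n%:R * (p%:~R / q%:R)) p).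
    by congr (nat_of_bool (window _)); rewrite natrD; field.
  congr muln.
  rewrite -(@sum_residues nat q p 0 (fun k => nat_of_bool (window (z + k%:~R / q%:R))))//.
    apply: eq_bigr => n _; congr (nat_of_bool (window _)).
    by rewrite addr0 intrM -pmulrn mulrA.
  move=> i k; rewrite -(windowDz (z + i%:~R / q%:R) k).
  by congr (nat_of_bool (window _)); rewrite intrD intrM -pmulrn; field.
rewrite -/T !TE; [|by move=> n /good[]|by move=> n /good[]].
have := sum_window_half y q0.
set b := (\sum_(i < q) _)%N; set b' := (\sum_(i < q) _)%N => bb.
rewrite !PoszM -mulrBr normrM (@ger0_norm _ q%:Z)// ler_peMr//.
by have := oq; rewrite -{1}bb oddD; lia.
Qed.

End Liouville.

(** * Fell topology on closed subsets of the line *)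

Section Line.
Context {R : realType}.
Implicit Types (S : set R) (y z : R).

Definition pt y : 'rV[R]_1 := const_mx y.
Definition line_set S : set 'rV[R]_1 := [set x | S (x ord0 ord0)].

Lemma ptE y i j : pt y i j = y. Proof. by rewrite mxE. Qed.
Lemma ptK (x : 'rV[R]_1) : pt (x ord0 ord0) = x.
Proof. by apply/rowP => i; rewrite ptE (ord1 i). Qed.
Lemma line_set_pt S y : line_set S (pt y) = S y.
Proof. by rewrite /line_set /= ptE. Qed.
Lemma ptD y z : pt (y + z) = pt y + pt z.
Proof. by apply/rowP => i; rewrite !mxE. Qed.
Lemma ptN y : pt (- y) = - pt y.
Proof. by apply/rowP => i; rewrite !mxE. Qed.

Lemma line_set_compact S : compact S -> compact (line_set S).
Proof.
move=> cS; have := @rV_compact R 1 (fun=> S) (fun=> cS).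
congr compact; apply/seteqP; split => x /=; first exact.
by move=> Sx i; rewrite (ord1 i).
Qed.

Lemma line_set_open S : open S -> open (line_set S).
Proof.
move=> oS; have -> : line_set S = (fun x : 'rV[R]_1 => x ord0 ord0) @^-1` S by [].
by apply: open_comp => // x _; exact: coord_continuous.
Qed.

Lemma pt_continuous : continuous pt.
Proof.
move=> y; apply/cvg_ballP => e e0.
have := @nbhsx_ballx R R y e e0; apply: filterS => z yz.
by split => // i j; rewrite !ptE.
Qed.

Lemma compact_coord (K : set 'rV[R]_1) : compact K -> compact [set y | K (pt y)].
Proof.
move=> cK.
have -> : [set y | K (pt y)] = (fun x : 'rV[R]_1 => x ord0 ord0) @` K.
  apply/seteqP; split => y /=; first by exists (pt y); rewrite ?ptE.
  by move=> [x Kx <-]; rewrite ptK.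
apply: continuous_compact => //; apply: continuous_subspaceT => x.
exact: coord_continuous.
Qed.

Lemma compact_coord_bounded (K : set 'rV[R]_1) : compact K ->
  exists B : nat, forall y, K (pt y) -> `|y| <= B%:R.
Proof.
move=> /compact_coord/compact_bounded[M [_ MP]].
exists (Num.truncn (Num.max M 0%R)).+1 => y Ky; apply: MP Ky.
apply: (@le_lt_trans _ _ (Num.max M 0)); first by rewrite le_max lexx.
exact: truncnS_gt.
Qed.

Definition pts (F : closed_set R 1) : set R := [set y | carrier F (pt y)].

(** Void events generate everything: the hit event of [S] is the complement of [misses S]. *)
Definition misses S : set (closed_set R 1) :=
  [set F : closed_set R 1 | forall y, S y -> ~ pts F y].

Lemma missesE S : misses S = [set F : closed_set R 1 | F `&` line_set S = set0].
Proof.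
apply/seteqP; split => F /=.
  move=> mF; rewrite -subset0 => x [Fx Sx].
  by apply: (mF _ Sx); rewrite /pts /= ptK.
by move=> /seteqP[s0 _] y Sy Fy; apply: (s0 (pt y)); rewrite /setI /= line_set_pt.
Qed.

Lemma not_misses S (F : closed_set R 1) :
  (~` misses S) F <-> exists2 y, S y & pts F y.
Proof.
split=> [|[y Sy Fy] /(_ _ Sy)//].
by move=> /existsNP[y /not_implyP[Sy /contrapT Fy]]; exists y.
Qed.

Lemma fell_subbase_open (X : set (closed_set R 1)) : fell_subbase X -> open X.
Proof.
move=> sX; exists [set X]; last by rewrite bigcup_set1.
by move=> _ ->; exact: finI_from1.
Qed.

Lemma misses_open S : compact S -> open (misses S).
Proof.
move=> cS; apply: fell_subbase_open; left; exists (line_set S); first exact: line_set_compact.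
by rewrite missesE.
Qed.

Lemma hits_open S : open S -> open (~` misses S).
Proof.
move=> oS; apply: fell_subbase_open; right; exists (line_set S); first exact: line_set_open.
apply/seteqP; split=> F /=.
  by move=> [x [Fx Sx]]; apply/not_misses; exists (x ord0 ord0) => //; rewrite /pts /= ptK.
by move=> /not_misses[y Sy Fy]; exists (pt y); split => //; rewrite line_set_pt.
Qed.

Lemma fell_basic (O : set (closed_set R 1)) F : open O -> O F ->
  exists E : seq (set (closed_set R 1)),
   (forall X, X \in E -> fell_subbase X /\ X F) /\
   (forall G : closed_set R 1, (forall X, X \in E -> X G) -> O G).
Proof.
move=> [D sD <-] [A DA AF].
have [E sE EA] := sD _ DA.
have AF' : A F by exact: AF.
exists (finmap.enum_fset E); split => [X XE|G GE].
  split; first by have := set_mem (sE _ XE).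
  by move: AF'; rewrite -EA => /(_ _ XE).
have AG : A G by rewrite -EA => X; exact: GE.
by exists A.
Qed.

Lemma fset_bound (T : eqType) (E : seq T) (P : T -> nat -> Prop) :
  (forall x m n, (m <= n)%N -> P x m -> P x n) ->
  (forall x, x \in E -> exists n, P x n) -> exists n, forall x, x \in E -> P x n.
Proof.
move=> mP EP; have /choice[f fP] : forall x, exists n, x \in E -> P x n.
  by move=> x; have [/EP[n Pn]|] := boolP (x \in E); [exists n|exists 0%N].
exists (\max_(x <- E) f x) => x xE; apply: mP (fP _ xE).
exact: (@leq_bigmax_seq _ _ xpredT).
Qed.

(** A hit condition is witnessed by one point and a miss condition concerns a compact set, so
    membership of [F] in an open set is decided within a bounded region. *)
Lemma fell_local (O : set (closed_set R 1)) F : open O -> O F ->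
  exists B : nat, forall G : closed_set R 1,
    (forall y, `|y| <= B%:R -> (pts F y <-> pts G y)) -> O G.
Proof.
move=> oO OF; have [E [EF EO]] := fell_basic oO OF.
pose P (X : set (closed_set R 1)) (B : nat) := forall G : closed_set R 1,
  (forall y, `|y| <= B%:R -> (pts F y <-> pts G y)) -> X G.
have monoP X m n : (m <= n)%N -> P X m -> P X n.
  by move=> mn XP G FG; apply: XP => y ym; apply: FG; rewrite (le_trans ym)// ler_nat.
have [X XE|B BP] := @fset_bound _ E P monoP; last first.
  by exists B => G FG; apply: EO => X XE; exact: BP.
have [[] [K KP <-] XF] := EF _ XE.
  have [B BP] := compact_coord_bounded KP; exists B => G FG /=.
  rewrite -subset0 => x [Gx Kx].
  have : (F `&` K) x; last by rewrite XF.
  by split => //; rewrite -(ptK x); apply/FG; rewrite /pts /= ?ptK//; apply: BP; rewrite ptK.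
case: XF => x [Fx Kx]; exists (Num.truncn `|x ord0 ord0|).+1 => G FG.
exists x; split => //; rewrite -(ptK x); apply/FG; rewrite /pts /= ?ptK//.
exact/ltW/truncnS_gt.
Qed.

Definition cells (m : nat) (s : seq int) : set R :=
  [set y | exists2 i, i \in s & i%:~R <= 2 ^+ m * y <= (i + 1)%:~R].

Lemma cells_compact m s : compact (cells m s).
Proof.
have pm : 0 < 2 ^+ m :> R by rewrite exprn_gt0.
have -> : cells m s = \bigcup_(i in [set` s]) `[i%:~R / 2 ^+ m, (i + 1)%:~R / 2 ^+ m]%classic.
  have itvE i y : (i%:~R <= 2 ^+ m * y <= (i + 1)%:~R) =
      (y \in `[i%:~R / 2 ^+ m, (i + 1)%:~R / 2 ^+ m]).
    by rewrite in_itv /= ler_pdivrMr// ler_pdivlMr// mulrC.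
  by apply/seteqP; split => y /= [i is_ iy]; exists i; rewrite //= ?itvE// -itvE.
rewrite bigcup_seq; apply: big_ind => [||i _]; first exact: compact0.
- exact: compactU.
- exact: segment_compact.
Qed.

Lemma cells_refine m s k : exists s', cells m s = cells (m + k) s'.
Proof.
elim: k => [|k [s' ->]]; first by exists s; rewrite addn0.
exists (flatten [seq [:: 2 * i; 2 * i + 1] | i <- s']); rewrite addnS.
apply/seteqP; split => y [i +  /andP[iy yi]]; last first.
  move=> /flatten_mapP[j js]; rewrite !inE => ij; exists j => //.
  move: ij iy yi; rewrite exprS -mulrA => /orP[] /eqP ->.
    by rewrite !intrD !intrM => ? ?; apply/andP; split; lra.
  by rewrite !intrD !intrM => ? ?; apply/andP; split; lra.
move=> is_; have [le|gt] := leP (2 ^+ (m + k).+1 * y) (2 * i + 1)%:~R.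
  exists (2 * i); first by apply/flatten_mapP; exists i => //; rewrite !inE eqxx.
  by rewrite le andbT intrM exprS -mulrA ler_wpM2l.
exists (2 * i + 1); first by apply/flatten_mapP; exists i => //; rewrite !inE eqxx orbT.
rewrite ltW//=.
have -> : (2 * i + 1 + 1)%:~R = 2 * (i + 1)%:~R :> R by rewrite !intrD intrM; ring.
by rewrite exprS -mulrA ler_wpM2l.
Qed.

Lemma mem_cells_floor m y s : Num.floor (2 ^+ m * y) \in s -> cells m s y.
Proof.
move=> fs; exists (Num.floor (2 ^+ m * y)) => //.
by have /andP[-> /ltW ->] := floor_itv (2 ^+ m * y).
Qed.

Lemma exists_pow2_gt (x : R) : exists m : nat, x < 2 ^+ m.
Proof.
exists (Num.truncn (Num.max 0 x)).+1.
apply: (@le_lt_trans _ _ (Num.max 0 x)); first by rewrite le_max lexx orbT.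
apply: lt_le_trans (truncnS_gt _) _.
by rewrite -natrX ler_nat ltnW// ltn_expl.
Qed.

Lemma closed_pts F : closed (pts F).
Proof.
have -> : pts F = pt @^-1` carrier F by [].
apply: preimage_closed; first by move=> x _; exact: pt_continuous.
exact: closed_carrier.
Qed.

Lemma cell_diameter m y z (i : int) : i%:~R <= 2 ^+ m * y <= (i + 1)%:~R ->
  i%:~R <= 2 ^+ m * z <= (i + 1)%:~R -> `|y - z| <= (2 ^+ m)^-1 :> R.
Proof.
have pm : 0 < 2 ^+ m :> R by rewrite exprn_gt0.
move=> /andP[y1 y2] /andP[z1 z2]; rewrite -[leRHS]mul1r ler_pdivlMr//.
rewrite -[X in _ * X](gtr0_norm pm) -normrM ler_norml mulrC.
by move: y1 y2 z1 z2; rewrite !intrD => *; apply/andP; split; lra.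
Qed.

(** By compactness the distance between the two sets exceeds the size of a cell once [m] is
    large. *)
Lemma cells_separate (C D : set R) : compact C -> closed D -> C `&` D = set0 ->
  exists m s, C `<=` cells m s /\ cells m s `&` D = set0.
Proof.
move=> cC cD CD.
have [M [_ MP]] := compact_bounded cC.
pose P (m : nat) (y : R) := forall z, D z -> (2 ^+ m)^-1 < `|y - z|.
have [m Pm] : exists m, C `<=` P m.
  have /compact_near_coveringP/(_ nat \oo P _) : compact C by [].
  case=> [y Cy|m _ mP]; last by exists m; apply: (mP m) => /=.
  have nDy : (~` D) y by move=> Dy; have : (C `&` D) y by []; rewrite CD.
  have [e /= e0 eD] : nbhs y (~` D) by apply: open_nbhs_nbhs; split => //; exact: closed_openC.
  have [m0 m0P] := exists_pow2_gt (2 / e).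
  near=> y' m => z Dz; rewrite ltNge; apply/negP => y'z.
  have me : (2 ^+ m)^-1 < e / 2.
    rewrite -[e / 2]invrK invf_div ltf_pV2 ?posrE ?exprn_gt0 ?divr_gt0//.
    apply: lt_le_trans m0P _; rewrite ler_weXn2l ?ler1n//.
    near: m; exact: nbhs_infty_ge.
  apply: (eD z) => //=; rewrite -[X in `|X|](subrKA y').
  apply: (le_lt_trans (ler_normD _ _)).
  have : `|y - y'| < e / 2 by near: y'; apply: (@nbhsx_ballx R R y (e / 2)); rewrite divr_gt0.
  by lra.
pose N := (Num.truncn (2 ^+ m * (`|M| + 1))).+1.
pose s := [seq i <- [seq k%:Z - N%:Z | k <- iota 0 (N + N)] |
             `[< exists2 y, C y & Num.floor (2 ^+ m * y) = i >]].
exists m, s; split => [y Cy|].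
  apply: mem_cells_floor; rewrite mem_filter; apply/andP; split.
    by apply/asboolP; exists y.
  set i := Num.floor _.
  have yM : `|2 ^+ m * y| < N%:R.
    apply: le_lt_trans (truncnS_gt _); rewrite normrM ger0_norm ?exprn_ge0// ler_wpM2l ?exprn_ge0//.
    by apply: (MP (`|M| + 1)) => //; rewrite (le_lt_trans (ler_norm _))// ltrDl.
  have [i1 i2] : - N%:Z <= i /\ i < N%:Z.
    move: yM; rewrite ltr_norml => /andP[y1 y2].
    by rewrite /i floor_ge_int floor_lt_int mulrNz -pmulrn ltW.
  apply/mapP; exists (absz (i + N%:Z)); last by lia.
  by rewrite mem_iota; lia.
rewrite -subset0 => z [[i]]; rewrite mem_filter => /andP[/asboolP[y Cy yi] _] zi Dz.
have /= := Pm _ Cy z Dz; rewrite ltNge => /negP; apply.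
apply: cell_diameter zi; rewrite -yi; by have /andP[-> /ltW ->] := floor_itv (2 ^+ m * y).
Unshelve. all: end_near. Qed.

(** A countable family of hit or miss conditions that refines every subbasic neighbourhood; its
    finite intersections do the work of a countable base, although hitting closed cells is
    not an open condition. *)
Definition atom (c : bool * nat * seq int) : set (closed_set R 1) :=
  if c.1.1 then misses (cells c.1.2 c.2) else ~` misses (cells c.1.2 c.2).

Lemma subbase_atom X F : fell_subbase X -> X F -> exists c, atom c F /\ atom c `<=` X.
Proof.
move=> [] [K KP <-] XF.
  have [|m [s [Ks sF]]] := cells_separate (compact_coord KP) (closed_pts (F := F)).
    rewrite -subset0 => y [/= Ky Fy]; have : (F `&` K) (pt y) by [].
    by rewrite XF.
  exists (true, m, s); split => /= [y sy Fy|G].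
    by have : (cells m s `&` pts F) y by []; rewrite sF.
  move=> mG /=; rewrite -subset0 => x [Gx Kx].
  apply: (mG (x ord0 ord0)); last by rewrite /pts /= ptK.
  by apply: Ks; rewrite /= ptK.
case: XF => x [Fx Kx]; set y := x ord0 ord0.
have [e /= e0 eK] : nbhs y [set y | K (pt y)].
  apply: open_nbhs_nbhs; split; last by rewrite /= ptK.
  have -> : [set y | K (pt y)] = pt @^-1` K by [].
  by apply: open_comp => // ? _; exact: pt_continuous.
have [m mP] := exists_pow2_gt e^-1.
exists (false, m, [:: Num.floor (2 ^+ m * y)]); split => /=.
  apply/not_misses; exists y; last by rewrite /pts /= ptK.
  by apply: mem_cells_floor; rewrite inE.
move=> G /not_misses[z [i]]; rewrite inE => /eqP -> zi Gz.
exists (pt z); split => //; apply: eK => /=.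
have : `|y - z| <= (2 ^+ m)^-1.
  by apply: cell_diameter zi; have /andP[-> /ltW ->] := floor_itv (2 ^+ m * y).
move=> /le_lt_trans; apply.
by rewrite -[e]invrK ltf_pV2 ?posrE ?exprn_gt0 ?invr_gt0.
Qed.

Lemma open_atoms (O : set (closed_set R 1)) F : open O -> O F ->
  exists cs : seq (bool * nat * seq int),
    (forall c, c \in cs -> atom c F) /\ (forall G, (forall c, c \in cs -> atom c G) -> O G).
Proof.
move=> oO OF; have [E [EF EO]] := fell_basic oO OF.
have /choice[f fP] : forall X, exists c, X \in E -> atom c F /\ atom c `<=` X.
  move=> X; have [/EF[sX XF]|XE] := boolP (X \in E); last by exists (true, 0%N, [::]).
  by have [c cP] := subbase_atom sX XF; exists c.
exists (map f E); split => [c /mapP[X XE ->]|G GE]; first by have [] := fP _ XE.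
apply: EO => X XE; have [_] := fP _ XE; apply.
by apply: GE; apply/mapP; exists X.
Qed.

(** Levels start at 2 so that the offset 1/4 of the second kind of points is a multiple of the
    mesh. *)
Definition void_events : set (set (fell_borel R 1)) :=
  [set A | exists m s, A = misses (cells m.+2 s)].

Lemma misses_setU S S' : misses (S `|` S') = misses S `&` misses S'.
Proof.
apply/seteqP; split => F /=.
  by move=> mF; split => y Sy; apply: mF; [left|right].
by move=> [m1 m2] y [/m1|/m2].
Qed.

Lemma cells_cat m s s' : cells m (s ++ s') = cells m s `|` cells m s'.
Proof.
apply/seteqP; split => y /=.
  by move=> [i]; rewrite mem_cat => /orP[] is_ iy; [left|right]; exists i.
by move=> [] [i is_ iy]; exists i => //; rewrite mem_cat is_ ?orbT.
Qed.

Lemma void_eventsI : setI_closed void_events.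
Proof.
move=> _ _ [m [s ->]] [m' [s' ->]].
have [t tE] := cells_refine m.+2 s m'; have [t' t'E] := cells_refine m'.+2 s' m.
exists (m + m')%N, (t ++ t'); rewrite cells_cat misses_setU tE t'E.
by congr (misses (cells _ _) `&` misses (cells _ _)); lia.
Qed.

Lemma void_events_measurable : void_events `<=` measurable.
Proof.
move=> _ [m [s ->]]; apply: sub_sigma_algebra; apply: misses_open; exact: cells_compact.
Qed.

(** The subbase of the topology is uncountable, but an open set is the union of the finite
    intersections of atoms that it contains, and there are only countably many of these. *)
Lemma fell_borel_void : measurable = <<s void_events >> :> set (set (fell_borel R 1)).
Proof.
apply/seteqP; split; last by apply: smallest_sub; [exact: sigma_algebra_measurable|exact: void_events_measurable].
apply: smallest_sub; first exact: smallest_sigma_algebra.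
move=> O oO.
pose T := g_sigma_algebraType void_events.
have matom c : measurable (atom c : set T).
  have mvoid m s : measurable (misses (cells m s) : set T).
    have [s' ->] := cells_refine m s 2; rewrite addn2.
    by apply: sub_sigma_algebra; exists m, s'.
  by rewrite /atom; case: ifP => _ //; apply: measurableC.
pose B (cs : seq (bool * nat * seq int)) : set T := \bigcap_(c in [set` cs]) atom c.
have mB cs : measurable (B cs).
  by rewrite /B bigcap_seq; apply: bigsetI_measurable.
pose D n : set T := if (unpickle n : option (seq (bool * nat * seq int))) is Some cs then
   (if `[< B cs `<=` O >] then B cs else set0) else set0.
suff -> : O = \bigcup_n D n.
  apply: (@bigcupT_measurable _ T) => n; rewrite /D.
  by case: unpickle => // cs; case: ifP.
apply/seteqP; split => F.
  move=> OF; have [cs [csF csO]] := open_atoms oO OF.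
  exists (pickle cs) => //; rewrite /D pickleK; case: asboolP => [_|[]].
    by move=> c; exact: csF.
  by move=> G BG; apply: csO => c; exact: BG.
by move=> [n _]; rewrite /D; case: unpickle => // cs; case: asboolP => // + BF; apply.
Qed.

End Line.

(** * Coded configurations and frequencies of their patterns *)

Section FullMeasure.
Context d (T : measurableType d) (R : realType) (P : probability T R).
Import HBNNSimple.
(** A simple function below [f] keeps its integral when it is cut to zero outside [A], so the
    comparison holds for arbitrary nonnegative functions. It serves for point counts, which
    are under control on the hull only. *)
Lemma ge0_le_integral_full (A : set T) (f g : T -> \bar R) :
  measurable A -> P A = 1%E -> (forall x, 0 <= f x)%E -> (forall x, 0 <= g x)%E ->
  (forall x, A x -> f x <= g x)%E -> (\int[P]_x f x <= \int[P]_x g x)%E.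
Proof.
move=> mA PA f0 g0 fg; rewrite !ge0_integralTE//.
apply: ge_ereal_sup => _ [h hf <-].
have PAC : P (~` A) = 0%E by rewrite probability_setC// PA subee.
have hE x : proj_nnsfun h mA x = (h \_ A) x by rewrite mrestrict.
apply: (@le_trans _ _ (sintegral P (proj_nnsfun h mA))); last first.
  apply: ereal_sup_ubound; exists (proj_nnsfun h mA) => // x.
  rewrite hE patchE; case: (boolP (x \in A)) => [/set_mem xA|_]; last exact: g0.
  by rewrite (le_trans (hf x))// fg.
rewrite -!integralT_nnsfun le_eqVlt; apply/orP; left; apply/eqP.
rewrite [LHS](@ge0_negligible_integral _ _ _ _ _ (~` A))//; first last.
- by move=> x _; rewrite lee_fin.
- exact/measurable_EFinP.
- exact: measurableC.
rewrite [RHS](@ge0_negligible_integral _ _ _ _ _ (~` A))//; first last.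
- by move=> x _; rewrite lee_fin.
- exact/measurable_EFinP.
- exact: measurableC.
apply: eq_integral => x; rewrite inE => -[_ /= /contrapT xA].
have := hE x; rewrite patchE mem_set// => hx.
by congr EFin; exact/esym.
Qed.

End FullMeasure.

Section Configurations.
Context {R : realType}.
Implicit Types (b : bool) (a t th y : R).

(** With [b] false this is the model set of the window, translated by [t]; with [b] true each
    remaining cell receives a point at offset 1/4, so that every cell has exactly one. A
    quarter, and not a half, makes the two kinds of points locally distinguishable. *)
Definition site b a t th : set R := [set y | exists k : int,
  (y = t + k%:~R /\ window (th - k%:~R * a)) \/
  [/\ b, y = t + k%:~R + 4^-1 & ~~ window (th - k%:~R * a)]].

Lemma site_gap b a t th y y' : site b a t th y -> site b a t th y' ->
  `|y - y'| < 3 / 4 -> y = y'.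
Proof.
have kE (k k' : int) (e e' : R) : 0 <= e <= 4^-1 -> 0 <= e' <= 4^-1 ->
    `|(t + k%:~R + e) - (t + k'%:~R + e')| < 3 / 4 -> k = k'.
  move=> ee ee'; rewrite ltr_norml => /andP[h1 h2].
  have : -1 < (k - k')%:~R :> R by rewrite intrB; lra.
  have : (k - k')%:~R < 1 :> R by rewrite intrB; lra.
  rewrite -[1]/1%:~R -mulrNz !ltr_int; lia.
have off z (k : int) : (z = t + k%:~R /\ window (th - k%:~R * a)) \/
    [/\ b, z = t + k%:~R + 4^-1 & ~~ window (th - k%:~R * a)] ->
    exists2 e, 0 <= e <= 4^-1 & z = t + k%:~R + e.
  move=> [[-> _]|[_ -> _]]; [exists 0; rewrite ?addr0//|exists 4^-1 => //]; apply/andP; split; lra.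
move=> [k kP] [k' kP'] yy'.
have kk' : k = k'.
  have [e ee yE] := off _ _ kP; have [e' ee' yE'] := off _ _ kP'.
  by apply: (kE _ _ _ _ ee ee'); rewrite -yE -yE'.
rewrite -{}kk' in kP'.
by case: kP => [[-> w]|[_ -> w]]; case: kP' => [[-> w']|[_ -> w']] //; [rewrite w in w'|rewrite w' in w].
Qed.

Lemma separated_closed (S : set R) e : 0 < e ->
  (forall y y', S y -> S y' -> `|y - y'| < e -> y = y') -> closed S.
Proof.
move=> e0 gap y cS.
have e20 : 0 < e / 2 by rewrite divr_gt0.
have [z [Sz /= yz]] := cS _ (@nbhsx_ballx R R y (e / 2) e20).
have [->//|ne] := eqVneq y z.
have d0 : 0 < Num.min (e / 2) `|y - z| by rewrite lt_min e20 normr_gt0 subr_eq0.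
have [z' [Sz' /= yz']] := cS _ (@nbhsx_ballx R R y _ d0).
move: yz yz'; rewrite /ball /= lt_min => yz /andP[yz' yz'2].
have zz' : z = z'.
  apply: gap => //; rewrite -(subrKA y) (le_lt_trans (ler_normD _ _))// distrC; lra.
by rewrite zz' ltxx in yz'2.
Qed.

Lemma line_set_closed (S : set R) : closed S -> closed (line_set S).
Proof.
move=> cS; have -> : line_set S = (fun x : 'rV[R]_1 => x ord0 ord0) @^-1` S by [].
by apply: preimage_closed => // x _; exact: coord_continuous.
Qed.

Lemma closed_site b a t th : closed (line_set (site b a t th)).
Proof.
have e0 : 0 < 3 / 4 :> R by lra.
by apply: line_set_closed; apply: (separated_closed e0) => y y'; exact: site_gap.
Qed.

Definition conf b a t th : closed_set R 1 := ClosedSet (closed_site (b := b) (a := a) (t := t) (th := th)).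

Lemma pts_conf b a t th : pts (conf b a t th) = site b a t th.
Proof. by apply/seteqP; split => y; rewrite /pts /mkset [carrier _ _]line_set_pt. Qed.

Lemma closed_set_ext (F G : closed_set R 1) : (forall y, pts F y <-> pts G y) -> F = G.
Proof.
move=> FG; have : carrier F = carrier G.
  by apply/seteqP; split => x; rewrite -(ptK x) => /FG.
case: F G {FG} => [F cF] [G cG] /= E; rewrite E in cF *.
by congr ClosedSet; exact: Prop_irrelevance.
Qed.

Lemma pts_translate s (F : closed_set R 1) y :
  pts (closed_set_translate (pt s) F) y <-> pts F (y - s).
Proof.
rewrite /pts /= /translate /=; split => [[x Fx xE]|Fx].
  by have -> : pt (y - s) = x by rewrite ptD ptN -xE addrK.
by exists (pt (y - s)) => //; rewrite ptD ptN subrK.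
Qed.

Lemma conf_translate b a t th s : closed_set_translate (pt s) (conf b a t th) = conf b a (t + s) th.
Proof.
apply: closed_set_ext => y; rewrite pts_translate !pts_conf.
by split=> -[k kP]; exists k; move: kP => [[yE w]|[bb yE w]]; [left|right|left|right]; split => //; lra.
Qed.

(** A unit translation acts on configurations as the rotation of the angle. *)
Lemma confD1 b a t th (n : int) : conf b a (t + n%:~R) th = conf b a t (th + n%:~R * a).
Proof.
apply: closed_set_ext => y; rewrite !pts_conf.
by split=> -[k kP]; [exists (k + n)|exists (k - n)];
  rewrite ?intrD ?mulrNz;
  (have -> : th + n%:~R * a - (k%:~R + n%:~R) * a = th - k%:~R * a by ring)
  || (have <- : th + n%:~R * a - k%:~R * a = th - (k%:~R - n%:~R) * a by ring);
  move: kP => [[yE w]|[bb yE w]]; [left|right|left|right]; split => //; lra.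
Qed.

Lemma conf_angleDz b a t th (n : int) : conf b a t (th + n%:~R) = conf b a t th.
Proof.
apply: closed_set_ext => y; rewrite !pts_conf.
have E (k : int) : window (th + n%:~R - k%:~R * a) = window (th - k%:~R * a).
  by rewrite -(windowDz (th - _) n); congr window; ring.
by split=> -[k kP]; exists k; move: kP; rewrite E.
Qed.

Definition half_cells (m : nat) (s : seq int) : set R := [set y | Num.floor (2 ^+ m * y) \in s].

Lemma half_cellsE m s y : half_cells m s y = (Num.floor (2 ^+ m * y) \in s) :> Prop.
Proof. by []. Qed.

(** The event of missing half-open dyadic cells, for a phase [t] with
    [u = floor (2 ^ m.+2 * t)]: since all points lie in [t] plus multiples of 1/4, nothing else
    about [t] matters. *)
Definition avoids b a (m : nat) (s : seq int) (u : int) th : bool :=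
  all (fun i => ~~ ((2 ^+ m.+2 %| i - u)%Z && window (th - (((i - u) %/ 2 ^+ m.+2)%Z)%:~R * a)) &&
    ~~ [&& b, (2 ^+ m.+2 %| i - u - 2 ^+ m)%Z &
       ~~ window (th - (((i - u - 2 ^+ m) %/ 2 ^+ m.+2)%Z)%:~R * a)]) s.

Lemma avoidsP b a m s t th :
  avoids b a m s (Num.floor (2 ^+ m.+2 * t)) th <-> misses (half_cells m.+2 s) (conf b a t th).
Proof.
set u := Num.floor _.
have D0 : 2 ^+ m.+2 != 0 :> int by rewrite expf_neq0.
have fl k : Num.floor (2 ^+ m.+2 * (t + k%:~R)) = u + k * 2 ^+ m.+2.
  rewrite /u -floorDz; congr Num.floor.
  by rewrite intrM rmorphXn /=; ring.
have fl4 k : Num.floor (2 ^+ m.+2 * (t + k%:~R + 4^-1)) = u + k * 2 ^+ m.+2 + 2 ^+ m.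
  rewrite -fl -floorDz; congr Num.floor.
  by rewrite rmorphXn /= !exprS; field.
split => [/allP av y|mis].
  rewrite pts_conf => ys [k [[yE w]|[bb yE w]]].
    have /andP[+ _] := av _ ys; rewrite yE fl addrC addKr dvdz_mull// mulzK//.
    by rewrite w.
  have /andP[_] := av _ ys; rewrite yE fl4.
  have -> : u + k * 2 ^+ m.+2 + 2 ^+ m - u - 2 ^+ m = k * 2 ^+ m.+2 by ring.
  by rewrite dvdz_mull// mulzK// bb w.
apply/allP => i is_; apply/andP; split; apply/negP.
  move=> /andP[/divzK]; set k := (_ %/ _)%Z => kE w.
  apply: (mis (t + k%:~R)); first by rewrite half_cellsE fl kE (_ : _ + _ = i)//; ring.
  by rewrite pts_conf; exists k; left.
move=> /and3P[bb /divzK]; set k := (_ %/ _)%Z => kE w.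
apply: (mis (t + k%:~R + 4^-1)); first by rewrite half_cellsE fl4 kE (_ : _ + _ = i)//; ring.
by rewrite pts_conf; exists k; right.
Qed.

Lemma avoidsDz b a m s u k th :
  avoids b a m s (u + k * 2 ^+ m.+2) th = avoids b a m s u (th + k%:~R * a).
Proof.
have D0 : 2 ^+ m.+2 != 0 :> int by rewrite expf_neq0.
apply: eq_all => i.
have -> : i - (u + k * 2 ^+ m.+2) = (- k) * 2 ^+ m.+2 + (i - u) by ring.
have -> : - k * 2 ^+ m.+2 + (i - u) - 2 ^+ m = (- k) * 2 ^+ m.+2 + (i - u - 2 ^+ m) by ring.
have dE x : (2 ^+ m.+2 %| - k * 2 ^+ m.+2 + x)%Z = (2 ^+ m.+2 %| x)%Z.
  by apply: rpredDl; rewrite dvdz_mull.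
rewrite !divzMDl// !dE.
have E (z : int) : th - (- k + z)%:~R * a = th + k%:~R * a - z%:~R * a.
  by rewrite intrD mulrNz; ring.
by rewrite !E.
Qed.

Lemma avoids_frequency b a m s u th q p : approximant a q p ->
  `|(\sum_(n < q) avoids b a m s u (th + n%:R * a)%R)%N%:Z -
    (\sum_(i < q) avoids b a m s u (i%:R / q%:R)%R)%N%:Z| <= (8 * size s)%N%:Z.
Proof.
move=> apq.
pose cs : seq R := [seq - (((i - u) %/ 2 ^+ m.+2)%Z)%:~R * a | i <- s] ++
  [seq - (((i - u - 2 ^+ m) %/ 2 ^+ m.+2)%Z)%:~R * a | i <- s].
have -> : (8 * size s = 4 * size cs)%N by rewrite size_cat !size_map addnn -mul2n mulnA.
apply: (orbit_frequency _ apq) => x y; rewrite all_cat !all_map => /andP[/allP h1 /allP h2].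
apply: eq_in_all => i is_.
by rewrite -!mulNr (eqP (h1 _ is_)) (eqP (h2 _ is_)).
Qed.

(** The translations by [r / 2 ^ m.+2 + n]: one period of the phase and [q] steps of the
    rotation. *)
Definition avoid_count b a m s (u : int) th (q : nat) :=
  (\sum_(r < 2 ^ m.+2) \sum_(n < q) avoids b a m s (u + r%:Z)%R (th + n%:R * a)%R)%N.

(** The phases [u + r] run through all residues modulo [2 ^ m.+2], whatever [u]; passing to the
    residue only turns the angle, to which [avoids_frequency] is insensitive. *)
Lemma avoid_count_uniform b a m s q p : approximant a q p -> exists C : nat, forall u th,
  `|(avoid_count b a m s u th q)%:Z - C%:Z| <= (2 ^ m.+2 * (8 * size s))%N%:Z.
Proof.
move=> apq; pose G (v : int) := (\sum_(i < q) avoids b a m s v (i%:R / q%:R)%R)%N.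
have E2 : (2 ^ m.+2)%N%:Z = 2 ^+ m.+2 by rewrite -natz natrX.
exists (\sum_(r < 2 ^ m.+2) G r%:Z)%N => u th.
pose v (r : nat) : int := ((u + r%:Z) %% 2 ^+ m.+2)%Z.
have -> : (\sum_(r < 2 ^ m.+2) G r%:Z = \sum_(r < 2 ^ m.+2) G (v r))%N.
  have := @sum_residues nat (2 ^ m.+2) 1 u (fun i => G (i %% 2 ^+ m.+2)%Z).
  rewrite expn_gt0 /coprimez gcd1z => /(_ isT isT) H.
  rewrite /v; under [RHS]eq_bigr do rewrite addrC -[X in (X + _)%R]mulr1.
  rewrite H; last by move=> i k; rewrite E2 addrC modzMDl.
  by apply: eq_bigr => r _; rewrite modz_small// -E2 ltz_nat ltn_ord.
rewrite -!natz /avoid_count !natr_sum -sumrB.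
apply: le_trans (ler_norm_sum _ _ _) _.
have -> : (2 ^ m.+2 * (8 * size s))%:R = \sum_(r < 2 ^ m.+2) (8 * size s)%N%:Z.
  by rewrite natz PoszM sumr_const card_ord mulrC -[RHS]mulr_natr natz.
apply: ler_sum => r _; rewrite !natz.
have Ev : u + r%:Z = v r + ((u + r%:Z) %/ 2 ^+ m.+2)%Z * 2 ^+ m.+2.
  by rewrite [LHS](divz_eq _ (2 ^+ m.+2)) addrC.
rewrite Ev; set k := (_ %/ _)%Z.
under eq_bigr do rewrite avoidsDz addrAC.
exact: (avoids_frequency _ _ _ _ _ apq).
Qed.

End Configurations.

(** * Averaging over translations *)

Lemma integral_cst_prob d (T : measurableType d) (R : realType) (P : probability T R) (c : R) :
  (\int[P]_x c%:E = c%:E)%E.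
Proof.
rewrite integral_cst// -[RHS]mule1; congr mule; exact: probability_setT.
Qed.

(** Integrate the number of indices [i] such that [x] belongs to [V i]. *)
Lemma average_le d (T : measurableType d) (R : realType) (P : probability T R) (A : set T)
    (I : finType) (V : I -> set T) (c : R) (N : nat) :
  measurable A -> P A = 1%E -> (forall i, measurable (V i)) -> (forall i, P (V i) = c%:E) ->
  (forall x, A x -> (\sum_i `[< V i x >] <= N)%N) -> #|I|%:R * c <= N%:R.
Proof.
move=> mA PA mV Vc AN.
rewrite -lee_fin.
have -> : ((#|I|%:R * c)%:E = \int[P]_x (\sum_i (\1_(V i) x)%:E))%E.
  rewrite ge0_integral_sum//; last by move=> i; exact/measurable_EFinP/measurable_indic.
  have iV i : (\int[P]_x (\1_(V i) x)%:E = c%:E)%E.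
    by rewrite integral_indic// setIT; exact: Vc.
  under eq_bigr => i _ do rewrite iV.
  by rewrite sumEFin sumr_const mulr_natl.
rewrite -(integral_cst_prob P N%:R).
apply: (ge0_le_integral_full mA PA) => //.
- by move=> x; apply: sume_ge0 => i _; rewrite lee_fin.
move=> x Ax /=; rewrite sumEFin lee_fin.
apply: le_trans (_ : (\sum_i `[< V i x >])%N%:R <= _); last by rewrite ler_nat AN.
rewrite natr_sum; apply: ler_sum => i _; rewrite indicE.
by have [/set_mem Vi|_] := boolP (x \in V i); rewrite ?ler0n// asboolT.
Qed.

Section Averages.
Context {R : realType}.
Implicit Types (b : bool) (a t th y : R) (U : set (fell_borel R 1)).

Lemma misses_translate (S : set R) x (F : closed_set R 1) :
  misses S (closed_set_translate (pt x) F) <-> misses [set y | S (y + x)] F.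
Proof.
split=> mis y Sy.
  by move=> Fy; apply: (mis _ Sy); rewrite pts_translate addrK.
by rewrite pts_translate => Fy; apply: (mis (y - x)) => //=; rewrite subrK.
Qed.

Definition shift_open U := forall x, open (closed_set_translate (pt x) @^-1` U : set (closed_set R 1)).

Lemma misses_shift_open (S : set R) : compact S -> shift_open (misses S).
Proof.
move=> cS x.
have -> : closed_set_translate (pt x) @^-1` misses S = misses [set y | S (y + x)].
  by apply/seteqP; split => F /misses_translate.
apply: misses_open.
have -> : [set y | S (y + x)] = (fun y => y - x) @` S.
  apply/seteqP; split => [y /= Sy|_ [y Sy <-]]; last by rewrite /= subrK.
  by exists (y + x) => //; rewrite addrK.
apply: continuous_compact => //; apply: continuous_subspaceT => y.
by apply: cvgB; [exact: cvg_id|exact: cvg_cst].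
Qed.

Lemma hits_shift_open (S : set R) : open S -> shift_open (~` misses S).
Proof.
move=> oS x.
have -> : closed_set_translate (pt x) @^-1` (~` misses S) = ~` misses [set y | S (y + x)].
  by apply/seteqP; split => F /= h /misses_translate.
apply: hits_open.
have -> : [set y | S (y + x)] = (fun y => y + x) @^-1` S by [].
apply: open_comp => // y _.
by apply: cvgD; [exact: cvg_id|exact: cvg_cst].
Qed.

Lemma open_fell_measurable (U : set (closed_set R 1)) : open U -> measurable (U : set (fell_borel R 1)).
Proof. exact: sub_sigma_algebra. Qed.

Lemma translate0 (F : closed_set R 1) : closed_set_translate (pt 0) F = F.
Proof. by apply: closed_set_ext => y; rewrite pts_translate subr0. Qed.

Lemma shift_open_open U : shift_open U -> open (U : set (closed_set R 1)).
Proof.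
move=> /(_ 0); congr open.
by apply/seteqP; split => F /=; rewrite translate0.
Qed.

(** The point sets of the theorem: [seed false a] is the first one and [seed true a] the union. *)
Definition seed b a : set 'rV[R]_1 := carrier (conf b a 0 0).

Lemma hull_meet b a (O : set (closed_set R 1)) F : open O -> hull (seed b a) F -> O F ->
  exists t, O (conf b a t 0).
Proof.
move=> oO hF OF; have [G [[x Gx] OG]] := hF _ (open_nbhs_nbhs (conj oO OF)).
exists (x ord0 ord0).
suff <- : G = conf b a (x ord0 ord0) 0 by [].
rewrite -[x ord0 ord0]add0r -conf_translate ptK.
by case: G Gx {OG} => G cG /= GE; move: cG; rewrite GE => cG; congr ClosedSet; exact: Prop_irrelevance.
Qed.

Lemma measurable_hull L : measurable (hull L : set (fell_borel R 1)).
Proof.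
rewrite -[hull L]setCK; apply: measurableC; apply: open_fell_measurable.
exact/closed_openC/closed_closure.
Qed.

(** Under an invariant law [U] has the probability of each of its translates. A member of the
    hull lying in some of these translates, which are open, has a translate of the seed in all
    of them, so the number of translates containing it is bounded by [N] as well. *)
Lemma open_frequency b a (Q : point_process_law R 1) (I : finType) (s : I -> R) U (N : nat) :
  invariant_on_hull (seed b a) Q -> shift_open U ->
  (forall t, (\sum_i `[< U (conf b a (t + s i) 0) >] <= N)%N) ->
  #|I|%:R * fine (Q U) <= N%:R.
Proof.
move=> [Qhull Qst] oU UN.
pose V i := closed_set_translate (pt (s i)) @^-1` U : set (fell_borel R 1).
have mV i : measurable (V i) by apply: open_fell_measurable; exact: oU.
have mU : measurable U by apply: open_fell_measurable; exact: shift_open_open.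
apply: (@average_le _ _ _ Q (hull (seed b a)) _ V) => //.
- exact: measurable_hull.
- by move=> i; rewrite fineK ?fin_num_measure//; exact: Qst.
move=> F hF.
pose O : set (closed_set R 1) := \bigcap_(i in [set i | V i F]) V i.
have [t Ot] : exists t, O (conf b a t 0).
  apply: (hull_meet (F := F)) hF _ => [|i //].
  rewrite /O bigcap_fset_set; last exact: finite_finset.
  by apply: big_ind => [|A B|i _]; [exact: openT|exact: openI|exact: oU].
apply: leq_trans (UN t); apply: leq_sum => i _.
case: asboolP => //= Vi.
by rewrite asboolT// -conf_translate; exact: (Ot i).
Qed.

End Averages.

(** * Unique ergodicity *)

Section UniqueErgodicity.
Context {R : realType}.
Implicit Types (b : bool) (a t th y : R) (U : set (fell_borel R 1)).

Lemma site_shift b a t s th y : site b a (t + s) th y <-> site b a t th (y - s).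
Proof. by rewrite -!pts_conf -conf_translate pts_translate. Qed.

Lemma sum_bool_le1 (I : finType) (P : I -> bool) :
  (forall i j, P i -> P j -> i = j) -> (\sum_i P i <= 1)%N.
Proof.
move=> P1; rewrite (eq_bigr (fun i => if P i then 1%N else 0%N)); last by move=> i _; case: (P i).
rewrite -big_mkcond sum1dep_card; apply/card_le1_eqP => i j.
by rewrite !inE => Pi Pj; apply: P1.
Qed.

Lemma measurable_misses (S : set R) : compact S -> measurable (misses S : set (fell_borel R 1)).
Proof. by move=> cS; apply: open_fell_measurable; exact: misses_open. Qed.

(** Translate by [J] multiples of a small step, over a total length 1/4. As the points of a
    configuration are 3/4 apart, at most one of these translations brings a point close to
    [y0], so the probability is at most [1 / J]. *)
Lemma hit_point_null b a (Q : point_process_law R 1) y0 :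
  invariant_on_hull (seed b a) Q -> Q (~` misses [set y0]) = 0%E.
Proof.
move=> Qinv.
have mp : measurable (~` misses [set y0] : set (fell_borel R 1)).
  by apply: measurableC; apply: measurable_misses; exact: compact_set1.
have key (J : nat) : (0 < J)%N -> J%:R * fine (Q (~` misses [set y0])) <= 1.
  move=> J0; have J0' : 0 < J%:R :> R by rewrite ltr0n.
  (* the J steps of length 2 e cover 1/4, well below the gap 3/4 between points *)
  pose e : R := (8 * J%:R)^-1.
  have e0 : 0 < e by rewrite invr_gt0 mulr_gt0.
  have eJ : e * J%:R = 8^-1 by rewrite /e; field; rewrite gt_eqF.
  pose B : set R := `]y0 - e, y0 + e[%classic.
  have oB : open B by exact: interval_open.
  have mB : measurable (~` misses B : set (fell_borel R 1)).
    by apply: open_fell_measurable; exact: hits_open.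
  pose s (j : 'I_J) : R := 2 * e * j%:R.
  have := @open_frequency R b a Q 'I_J s (~` misses B) 1 Qinv (hits_shift_open oB).
  rewrite card_ord => H; apply: le_trans (H _); last first.
    move=> t; apply: sum_bool_le1 => i j.
    move=> /asboolP/not_misses[y By]; rewrite pts_conf site_shift => yi.
    move: By; rewrite /B /= in_itv /= => /andP[y1 y2].
    move=> /asboolP/not_misses[z Bz]; rewrite pts_conf site_shift => zi.
    move: Bz; rewrite /B /= in_itv /= => /andP[z1 z2].
    have ij : `|s i - s j| <= 2 * e * J%:R.
      rewrite /s -mulrBr normrM ger0_norm ?ler_wpM2l//; try lra.
      have iJ : i%:R <= J%:R :> R by rewrite ler_nat ltnW.
      have jJ : j%:R <= J%:R :> R by rewrite ler_nat ltnW.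
      have i0 : 0 <= i%:R :> R by [].
      have j0 : 0 <= j%:R :> R by [].
      by rewrite ler_norml; apply/andP; split; lra.
    have J1 : 1 <= J%:R :> R by rewrite ler1n.
    have eJ' : e <= e * J%:R by rewrite ler_peMr// ltW.
    move: ij; rewrite ler_norml => /andP[ij1 ij2].
    have yz : y - s i = z - s j.
      apply: site_gap yi zi _; rewrite ltr_norml; apply/andP; split; lra.
    have [sij1 sij2] : - (2 * e) < s i - s j /\ s i - s j < 2 * e by split; lra.
    apply/val_inj/eqP; rewrite eqn_leq; apply/andP; split; rewrite leqNgt; apply/negP => lt.
      have : j%:R + 1 <= i%:R :> R by rewrite natr1 ler_nat.
      move=> le; have : 2 * e * (j%:R + 1) <= 2 * e * i%:R by rewrite ler_wpM2l//; lra.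
      by move: sij1 sij2; rewrite /s; lra.
    have : i%:R + 1 <= j%:R :> R by rewrite natr1 ler_nat.
    move=> le; have : 2 * e * (i%:R + 1) <= 2 * e * j%:R by rewrite ler_wpM2l//; lra.
    by move: sij1 sij2; rewrite /s; lra.
  rewrite ler_wpM2l// fine_le ?fin_num_measure// le_measure ?inE//.
  move=> F /not_misses[_ -> Fy]; apply/not_misses; exists y0 => //.
  by rewrite /B /= in_itv /=; apply/andP; split; lra.
have : fine (Q (~` misses [set y0])) <= 0.
  rewrite leNgt; apply/negP => p0.
  have := key (Num.truncn (fine (Q (~` misses [set y0])))^-1).+1 isT.
  rewrite leNgt -ltr_pdivrMr//  div1r.
  rewrite truncnS_gt //.
move=> le0; apply/eqP; rewrite eq_le measure_ge0 andbT.
by rewrite -[Q _]fineK ?fin_num_measure// lee_fin.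
Qed.

Lemma hit_finite_null b a (Q : point_process_law R 1) (l : seq R) :
  invariant_on_hull (seed b a) Q ->
  measurable (~` misses [set` l] : set (fell_borel R 1)) /\ Q (~` misses [set` l]) = 0%E.
Proof.
move=> Qinv; elim: l => [|y l [ml IH]].
  have -> : ~` misses [set` [::]] = set0 :> set (fell_borel R 1).
    by rewrite -subset0 => F /not_misses[y].
  by split => //; exact: measure0.
have -> : ~` misses [set` y :: l] = ~` misses [set y] `|` ~` misses [set` l] :> set (fell_borel R 1).
  rewrite -setCI -misses_setU; congr (~` misses _); apply/seteqP; split => z /=.
    by rewrite inE => /orP[/eqP|]; [left|right].
  by rewrite inE => -[->|->]; rewrite ?eqxx ?orbT.
have my : measurable (~` misses [set y] : set (fell_borel R 1)).
  by apply: measurableC; apply: measurable_misses; exact: compact_set1.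
split; first exact: measurableU.
apply/eqP; rewrite eq_le measure_ge0 andbT.
apply: le_trans (measureU2 _ my ml) _.
by rewrite [X in (X + _)%E](hit_point_null y Qinv) [X in (_ + X)%E]IH adde0.
Qed.

Definition open_cells (m : nat) (s : seq int) : set R :=
  [set y | exists2 i, i \in s & i%:~R < 2 ^+ m * y < (i + 1)%:~R].

Lemma open_open_cells m s : open (open_cells m s).
Proof.
have pm : 0 < 2 ^+ m :> R by rewrite exprn_gt0.
have -> : open_cells m s = \bigcup_(i in [set` s]) `]i%:~R / 2 ^+ m, (i + 1)%:~R / 2 ^+ m[%classic.
  have itvE i y : (i%:~R < 2 ^+ m * y < (i + 1)%:~R) =
      (y \in `]i%:~R / 2 ^+ m, (i + 1)%:~R / 2 ^+ m[).
    by rewrite in_itv /= ltr_pdivrMr// ltr_pdivlMr// mulrC.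
  by apply/seteqP; split => y /= [i is_ iy]; exists i; rewrite //= ?itvE// -itvE.
by apply: bigcup_open => i _; exact: interval_open.
Qed.

Lemma open_cells_half m s : open_cells m s `<=` half_cells m s.
Proof.
move=> y [i is_ /andP[/ltW iy yi]]; rewrite half_cellsE.
by rewrite (floor_def (m := i))// iy.
Qed.

Lemma half_cells_cells m s : half_cells m s `<=` @cells R m s.
Proof. by move=> y; exact: mem_cells_floor. Qed.

(** Missing the closed cells and hitting the open ones are open events, so [open_frequency] bounds
    both probabilities from above. They add up to at least 1, because only configurations
    hitting one of the finitely many endpoints satisfy neither; hence both bounds are sharp up
    to the error. The value [c] is the frequency along the orbit and does not involve the law. *)
Lemma void_probability b a m s q p : approximant a q p -> exists c : R,
  forall Q : point_process_law R 1, invariant_on_hull (seed b a) Q ->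
   `|fine (Q (misses (cells m.+2 s))) - c| <= (8 * size s)%N%:R / q%:R.
Proof.
move=> apq; have [q0 _ _ _] := apq.
have [C CP] := avoid_count_uniform b m s apq.
set E := (2 ^ m.+2 * (8 * size s))%N in CP.
pose J := (2 ^ m.+2 * q)%N.
have J0 : 0 < J%:R :> R by rewrite ltr0n muln_gt0 expn_gt0 q0.
exists (C%:R / J%:R) => Q Qinv.
pose I := ('I_(2 ^ m.+2) * 'I_q)%type.
pose sh (i : I) : R := i.1%:R / 2 ^+ m.+2 + i.2%:R.
have cI : #|{: I}| = J by rewrite card_prod !card_ord.
pose av t (i : I) := avoids b a m s (Num.floor (2 ^+ m.+2 * t) + i.1%:Z) (0 + i.2%:R * a).
have avE t i : av t i <-> misses (half_cells m.+2 s) (conf b a (t + sh i) 0).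
  rewrite /sh addrA (pmulrn 1 i.2) confD1 -avoidsP /av -pmulrn.
  suff -> : Num.floor (2 ^+ m.+2 * (t + i.1%:R / 2 ^+ m.+2)) =
    Num.floor (2 ^+ m.+2 * t) + i.1%:Z by [].
  rewrite -floorDz; congr Num.floor; rewrite -pmulrn; field.
  by rewrite expf_neq0.
have sumav t : (\sum_i av t i = avoid_count b a m s (Num.floor (2 ^+ m.+2 * t)) 0 q)%N.
  by rewrite /avoid_count pair_bigA.
have sumnav t : (\sum_i av t i + \sum_i ~~ av t i = J)%N.
  rewrite -big_split /= -cI -sum1_card; by apply: eq_bigr => i _; case: (av t i).
have ub1 : J%:R * fine (Q (misses (cells m.+2 s))) <= (C + E)%N%:R.
  rewrite -cI; apply: (@open_frequency R b a Q I sh _ _ Qinv).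
    by apply: misses_shift_open; exact: cells_compact.
  move=> t; apply: (@leq_trans (\sum_i av t i)).
    apply: leq_sum => i _; case: asboolP => //= mi; rewrite lt0b.
    by apply/avE => y /half_cells_cells; exact: mi.
  by rewrite sumav; have := CP (Num.floor (2 ^+ m.+2 * t)) 0; lia.
have CJ : (C <= J + E)%N.
  have := sumnav 0; rewrite sumav => Jle.
  have := CP (Num.floor (2 ^+ m.+2 * (0 : R))) 0.
  by move: Jle; set X := avoid_count _ _ _ _ _ _ _; clearbody X E; lia.
have ub2 : J%:R * fine (Q (~` misses (open_cells m.+2 s))) <= (J + E - C)%N%:R.
  rewrite -cI; apply: (@open_frequency R b a Q I sh _ _ Qinv).
    by apply: hits_shift_open; exact: open_open_cells.
  move=> t; apply: (@leq_trans (\sum_i ~~ av t i)).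
    apply: leq_sum => i _; case: asboolP => //= /not_misses[y sy yc]; rewrite lt0b.
    apply/negP => /avE mi; apply: mi yc; exact: open_cells_half.
  have := sumnav t; rewrite sumav cI; have := CP (Num.floor (2 ^+ m.+2 * t)) 0; lia.
(* the endpoints of the cells, the only points at which neither event is decided *)
pose bd : seq R := [seq i%:~R / 2 ^+ m.+2 | i <- s] ++ [seq (i + 1)%:~R / 2 ^+ m.+2 | i <- s].
have [mbd Qbd] := hit_finite_null bd Qinv.
have m1 : measurable (misses (cells m.+2 s) : set (fell_borel R 1)).
  by apply: measurable_misses; exact: cells_compact.
have m2 : measurable (~` misses (open_cells m.+2 s) : set (fell_borel R 1)).
  by apply: open_fell_measurable; apply: hits_open; exact: open_open_cells.
have m12 := measurableU _ _ m1 m2; have m123 := measurableU _ _ m12 mbd.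
have cover : 1 <= fine (Q (misses (cells m.+2 s))) + fine (Q (~` misses (open_cells m.+2 s))).
  rewrite -lee_fin EFinD !fineK ?fin_num_measure//.
  have -> : 1%E = Q setT by rewrite -(probability_setT Q).
  rewrite -[leRHS]adde0 -Qbd.
  apply: (@le_trans _ _ (Q ((misses (cells m.+2 s) `|` ~` misses (open_cells m.+2 s)) `|` ~` misses [set` bd]))).
    apply: le_measure; rewrite ?inE//.
    move=> F _; have [mF|nF] := pselect (misses (cells m.+2 s) F); first by left; left.
    have [y [i is_ /andP[iy yi]] Fy] := (not_misses _ _).1 nF.
    have pm : 0 < 2 ^+ m.+2 :> R by rewrite exprn_gt0.
    have [iy'|iy'] := eqVneq (i%:~R) (2 ^+ m.+2 * y).
      right; apply/not_misses; exists y => //=; rewrite mem_cat; apply/orP; left.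
      by apply/mapP; exists i => //; rewrite iy' mulrC mulKf// gt_eqF.
    have [yi'|yi'] := eqVneq (2 ^+ m.+2 * y) (i + 1)%:~R.
      right; apply/not_misses; exists y => //=; rewrite mem_cat; apply/orP; right.
      by apply/mapP; exists i => //; rewrite -yi' mulrC mulKf// gt_eqF.
    left; right; apply/not_misses; exists y => //; exists i => //.
    by rewrite !lt_neqAle iy yi iy' yi'.
  apply: le_trans (measureU2 _ m12 mbd) _.
  by apply: leeD2r; exact: (measureU2 _ m1 m2).
have -> : (8 * size s)%N%:R / q%:R = E%:R / J%:R :> R.
  by rewrite [E%:R]natrM [J%:R]natrM -mulf_div divff ?mul1r// pnatr_eq0.
rewrite ler_norml -mulNr -[X in _ <= _ - X <= _]mulrC.
move: ub2; rewrite natrB// !natrD in ub1 * => ub2.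
have {}cover := ler_wpM2l (ltW J0) cover; rewrite mulr1 mulrDr in cover.
apply/andP; split.
  rewrite ler_pdivrMr// mulrBl [J%:R^-1 * _]mulrC divfK ?gt_eqF// mulrC; lra.
rewrite ler_pdivlMr// mulrBl [J%:R^-1 * _]mulrC divfK ?gt_eqF// mulrC; lra.
Qed.

Lemma uniquely_ergodic b a (P Q : point_process_law R 1) : liouville_like a ->
  invariant_on_hull (seed b a) P -> invariant_on_hull (seed b a) Q ->
  forall A : set (fell_borel R 1), measurable A -> Q A = P A.
Proof.
move=> la Pinv Qinv A mA.
apply: (measure_unique void_events (fun=> setT)) => //.
- exact: fell_borel_void.
- exact: void_eventsI.
- move=> _; exists 0%N, [::]; apply/seteqP; split => // F _ y.
  by case.
- by rewrite bigcup_const//; exists 0%N.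
- move=> _ [m [s ->]].
  have mm : measurable (misses (cells m.+2 s) : set (fell_borel R 1)).
    by apply: measurable_misses; exact: cells_compact.
  rewrite -[LHS]fineK ?fin_num_measure// -[RHS]fineK ?fin_num_measure//; congr EFin.
  apply/eqP; rewrite -subr_eq0 -normr_le0; apply/ler_addgt0Pr => e e0; rewrite add0r.
  have [q [p [qe _ apq _]]] := la (Num.truncn ((16 * size s)%N%:R / e)).+1.
  have [c cP] := void_probability b m s apq.
  have := cP _ Pinv; have := cP _ Qinv.
  set x := fine _; set y := fine _ => xc yc.
  have : (8 * size s)%N%:R / q%:R + (8 * size s)%N%:R / q%:R <= e.
    have q0 : 0 < q%:R :> R by rewrite ltr0n; lia.
    rewrite -mulrDl -natrD ler_pdivrMr// mulrC -ler_pdivrMr//.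
    have -> : (8 * size s + 8 * size s = 16 * size s)%N by lia.
    by apply: ltW; apply: lt_le_trans (truncnS_gt _) _; rewrite ler_nat.
  apply: le_trans; rewrite -(subrKA c) (le_trans (ler_normD _ _))// lerD//.
  by rewrite distrC.
- by move=> _; rewrite -ge0_fin_numE ?fin_num_measure.
Qed.

End UniqueErgodicity.

(** * Members of the hull and integration on the circle *)

Section Hull.
Context {R : realType}.
Implicit Types (b : bool) (a t th y : R).

Lemma window_right (z : R) : exists n : nat, forall h, 0 <= h <= n.+1%:R^-1 -> window (z + h) = window z.
Proof.
have /andP[f1 f2] := floor_itv (2 * z); set f := Num.floor _ in f1 f2.
have g0 : 0 < (f + 1)%:~R - 2 * z by rewrite subr_gt0.
exists (Num.truncn (2 / ((f + 1)%:~R - 2 * z))) => h /andP[h0 hn].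
apply: floor_eq_window; rewrite -/f; apply: floor_def; apply/andP; split; first lra.
have : h < ((f + 1)%:~R - 2 * z) / 2.
  apply: le_lt_trans hn _; rewrite -[X in _ < X]invrK invf_div ltf_pV2 ?posrE ?divr_gt0//.
  by apply: truncnS_gt; rewrite divr_ge0// ltW.
lra.
Qed.

(** Moving the angle slightly to the right changes no window value that is visible in a bounded
    region, even if an orbit point sits on the boundary of the window; so every configuration,
    and not just almost every one, is a limit of translates of the seed. *)
Lemma conf_in_hull b a t th : liouville_like a -> hull (seed b a) (conf b a t th).
Proof.
move=> la O; rewrite nbhsE; move=> [U [oU Uc] sU].
have [N NP] := fell_local oU Uc.
(* only cells of index in [- K, K) can meet the ball of radius N *)
pose K := (N + Num.truncn `|t|).+2.
pose ks := [seq th - (k%:Z - K%:Z)%:~R * a | k <- iota 0 (K + K)].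
pose P (z : R) (n : nat) := forall h, 0 <= h <= n.+1%:R^-1 -> window (z + h) = window z.
have monoP z m n : (m <= n)%N -> P z m -> P z n.
  move=> mn zm h /andP[h0 hn]; apply: zm; rewrite h0 (le_trans hn)//.
  by rewrite lef_pV2 ?posrE// ler_nat.
have [z _|n nP] := @fset_bound _ ks P monoP; first exact: window_right.
have appr (Q : nat) : exists2 q : nat, (Q <= q)%N & exists p, approximant a q p.
  by have [q [p [Qq _ apq _]]] := la Q; exists q => //; exists p.
have n0 : 0 < n.+1%:R^-1 :> R by rewrite invr_gt0.
have [l [k /andP[kl lk]]] := orbit_right_dense th appr n0.
exists (conf b a (t + l%:R) 0); split.
  exists (pt (t + l%:R)).
  have := conf_translate b a 0 0 (t + l%:R); rewrite add0r => /(congr1 (@carrier R 1)) <-.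
  by [].
apply: sU; apply: NP => y yN.
have -> : conf b a (t + l%:R) 0 = conf b a t (l%:R * a + k%:~R).
  by rewrite conf_angleDz (pmulrn 1 l) confD1 add0r.
rewrite !pts_conf.
have wE (i : int) : - K%:Z <= i -> i < K%:Z ->
    window (l%:R * a + k%:~R - i%:~R * a) = window (th - i%:~R * a).
  move=> i1 i2.
  have -> : l%:R * a + k%:~R - i%:~R * a = th - i%:~R * a + (l%:R * a + k%:~R - th) by ring.
  apply: nP; last by rewrite subr_ge0 kl lerBlDr [leRHS]addrC ltW.
  apply/mapP; exists (absz (i + K%:Z)); first by rewrite mem_iota; lia.
  by rewrite gez0_abs ?addrK//; lia.
have iK (i : int) (e : R) : 0 <= e <= 4^-1 -> y = t + i%:~R + e -> - K%:Z <= i /\ i < K%:Z.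
  move=> /andP[e0 e4] yE.
  have tT := truncnS_gt `|t|; rewrite ler_norml in yN.
  have KE : K%:R = N%:R + (Num.truncn `|t|).+1%:R + 1 :> R.
    by rewrite /K -addnS -addn1 !natrD.
  have := ler_norm t; have := ler_norm (- t); rewrite normrN => t1 t2.
  case/andP: yN => y1 y2.
  have : - K%:R <= i%:~R :> R by lra.
  have : i%:~R < K%:R :> R by lra.
  by rewrite (pmulrn 1 K) -mulrNz ler_int ltr_int.
have i0 i : y = t + i%:~R -> - K%:Z <= i /\ i < K%:Z.
  by move=> yE; apply: (iK i 0); rewrite ?addr0//; apply/andP; split; lra.
have i4 i : y = t + i%:~R + 4^-1 -> - K%:Z <= i /\ i < K%:Z.
  by apply: iK; apply/andP; split; lra.
split=> -[i iP]; exists i; move: iP => [[yE w]|[bb yE w]].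
- by have [i1 i2] := i0 _ yE; left; rewrite wE.
- by have [i1 i2] := i4 _ yE; right; rewrite wE.
- by have [i1 i2] := i0 _ yE; left; rewrite -wE.
- by have [i1 i2] := i4 _ yE; right; rewrite -wE.
Qed.

End Hull.

Section Periodic.
Context {R : realType}.
Local Notation mu := (@lebesgue_measure R).

Lemma measurable_shift (s : R) :
  measurable_fun setT (fun x : measurableTypeR R => x + s : measurableTypeR R).
Proof. by apply: measurable_funD => //; exact: measurable_cst. Qed.

Lemma lebesgue_measure_shift (s : R) (A : set R) : measurable A ->
  pushforward mu (fun x : measurableTypeR R => x + s : measurableTypeR R) A = mu A.
Proof.
move=> mA; apply/esym.
have := @lebesgue_measure_unique R
  (pushforward mu (fun x : measurableTypeR R => x + s : measurableTypeR R)).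
move=> /(_ (measurable_shift s)); apply => // _ [[c d]] _ <-; rewrite /pushforward.
have E : (fun x : R => x + s) @^-1` `]c, d] = `]c - s, d - s]%classic.
  by apply/seteqP; split => x /=; rewrite !in_itv /= ltrBlDr lerBrDr.
change (mu `]c, d] = mu ((fun x : R => x + s) @^-1` `]c, d])).
rewrite E !lebesgue_measure_itv /= !lte_fin ltrD2r.
by case: ifP => //; rewrite -!EFinB => _; congr EFin; ring.
Qed.

Lemma ge0_integral_shift (g : R -> \bar R) (s c d : R) :
  measurable_fun setT g -> (forall x, 0 <= g x)%E ->
  (\int[mu]_(x in `[c, d[) g (x + s)%R = \int[mu]_(x in `[(c + s)%R, (d + s)%R[) g x)%E.
Proof.
move=> mg g0.
have -> : `[c, d[%classic = (fun x : R => x + s) @^-1` `[(c + s)%R, (d + s)%R[.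
  by apply/seteqP; split => x /=; rewrite !in_itv /= lerD2r ltrD2r.
rewrite -[LHS](@ge0_integral_pushforward _ _ _ _ _ _ (measurable_shift s))//; last first.
  exact: measurable_funS mg.
apply: eq_measure_integral; first exact: measurable_shift.
by move=> mf A mA _; exact: lebesgue_measure_shift.
Qed.

Lemma ge0_integral_cat (g : R -> \bar R) (c d e : R) : c <= d -> d <= e ->
  measurable_fun setT g -> (forall x, 0 <= g x)%E ->
  (\int[mu]_(x in `[c, e[) g x = \int[mu]_(x in `[c, d[) g x + \int[mu]_(x in `[d, e[) g x)%E.
Proof.
move=> cd de mg g0; rewrite -ge0_integral_setU//.
- congr (integral _ _ _); apply/seteqP; split => x /=; rewrite !in_itv /=.
    by move=> /andP[cx xe]; case: (ltP x d) => dx; [left|right]; rewrite ?cx ?xe.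
  by move=> [/andP[cx xd]|/andP[dx xe]]; [rewrite cx (lt_le_trans xd)|rewrite (le_trans cd)].
- exact: measurable_funS mg.
- apply/disj_setPLR => x /=; rewrite !in_itv /= => /andP[_ xd] /andP[dx _].
  by move: (lt_le_trans xd dx); rewrite ltxx.
Qed.

Definition unif : probability (measurableTypeR R) R := uniform_prob (@ltr01 R).

Lemma unifE (g : R -> \bar R) : measurable_fun setT g -> (forall x, 0 <= g x)%E ->
  (\int[unif]_x g x = \int[mu]_(x in `[0%R, 1%R[) g x)%E.
Proof.
move=> mg g0; rewrite /unif /= integral_uniform// subr0 invr1 mul1e.
by rewrite integral_itv_bndo_bndc//; exact: measurable_funS mg.
Qed.

(** After translating Lebesgue measure, cut the interval at 1 and move the second piece back by
    one period. *)
Lemma unif_shift (g : R -> \bar R) (s : R) : measurable_fun setT g -> (forall x, 0 <= g x)%E ->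
  (forall x, g (x + 1) = g x) -> (\int[unif]_x g (x + s)%R = \int[unif]_x g x)%E.
Proof.
move=> mg g0 g1.
have gn (n : nat) x : g (x + n%:R) = g x.
  by elim: n => [|n IH]; rewrite ?addr0// -natr1 addrA g1.
have gz (k : int) x : g (x + k%:~R) = g x.
  case: k => n; first by rewrite -pmulrn gn.
  by rewrite -[LHS](gn n.+1) NegzE mulrNz -pmulrn subrK.
pose r := s - (Num.floor s)%:~R.
have /andP[s0 s1] := floor_itv s.
have r0 : 0 <= r by rewrite subr_ge0.
have r1 : r <= 1 by move: s1; rewrite intrD /r => s1; lra.
have -> : (fun x => g (x + s)) = (fun x => g (x + r)).
  by apply/funext => x; rewrite -[RHS](gz (Num.floor s)) /r addrA subrK.
have mgs (t : R) : measurable_fun setT (fun x : R => g (x + t)).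
  exact: (measurableT_comp mg (measurable_shift t)).
rewrite !unifE//
 (ge0_integral_shift r 0 1 mg g0) add0r.
have r1' : 1 <= 1 + r by rewrite lerDl.
rewrite (ge0_integral_cat r1 r1' mg g0) (ge0_integral_cat r0 r1 mg g0) addeC; congr adde.
have := ge0_integral_shift 1 0 r mg g0; rewrite add0r [r + 1]addrC => <-.
by apply: eq_integral => x _; rewrite g1.
Qed.

Lemma unif_shift_set (B : set R) (s : R) : measurable B -> (forall x, B (x + 1) <-> B x) ->
  unif [set x | B (x + s)] = unif B.
Proof.
move=> mB B1.
have mBs : measurable ((fun x : R => x + s) @^-1` B).
  by rewrite -[X in measurable X]setTI; exact: measurable_shift.
have iE (A : set R) : measurable A -> unif A = (\int[unif]_x (\1_A x)%:E)%E.
  by move=> mA; rewrite integral_indic// setIT.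
rewrite !iE//.
have := @unif_shift (fun x => (\1_B x)%:E) s; apply => //.
- exact/measurable_EFinP/measurable_indic.
- move=> x; congr (_%:R%:E); congr nat_of_bool.
  by apply/idP/idP; rewrite !inE => /B1.
Qed.

End Periodic.

(** * The stationary law *)

Section Law.
Context {R : realType}.
Implicit Types (b : bool) (a t th y : R).

Lemma countable_bigcup_measurable d (T : measurableType d) (I : countType) (F : I -> set T) :
  (forall i, measurable (F i)) -> measurable (\bigcup_i F i).
Proof.
move=> mF.
have -> : \bigcup_i F i = \bigcup_n (if (unpickle n : option I) is Some i then F i else set0).
  apply/seteqP; split => x.
    by move=> [i _ Fi]; exists (pickle i) => //; rewrite pickleK.
  by move=> [n _]; case: unpickle => // i Fi; exists i.
by apply: bigcupT_measurable => n; case: unpickle.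
Qed.

Lemma measurable_window : measurable [set y : R | window y].
Proof.
have -> : [set y : R | window y] = \bigcup_(j : int) `[j%:~R, j%:~R + 2^-1[%classic.
  have wfrac (y : R) : window y = window (y - (Num.floor y)%:~R) by rewrite -mulrNz windowDz.
  apply/seteqP; split => y /=.
    move=> wy; exists (Num.floor y) => //=; rewrite in_itv /=.
    have /andP[f1 f2] := floor_itv y; rewrite f1 /=.
    rewrite ltNge; apply/negP => f3; move: wy; rewrite wfrac; apply/negP/nwindow_itv.
    by move: f2; rewrite intrD => f2; apply/andP; split; lra.
  move=> [j _ /=]; rewrite in_itv /= => /andP[j1 j2].
  have -> : y = (y - j%:~R) + j%:~R by rewrite subrK.
  by rewrite windowDz; apply: window_itv; apply/andP; split; lra.
by apply: countable_bigcup_measurable => j; exact: measurable_itv.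
Qed.

Lemma measurable_preimage_shift (A : set R) (s : R) : measurable A ->
  measurable [set x : R | A (x + s)].
Proof.
by move=> mA; rewrite -[X in measurable X]setTI; exact: measurable_shift.
Qed.

Definition conf_map b a (w : measurableTypeR R * measurableTypeR R) : fell_borel R 1 :=
  conf b a w.1 w.2.

Lemma measurable_conf_map b a : measurable_fun setT (conf_map b a).
Proof.
apply: (measurability void_events); first exact: fell_borel_void.
move=> _ [_ [m [s ->]] <-]; rewrite setTI.
set S := cells m.+2 s.
have mS : measurable S by apply: compact_measurable; exact: cells_compact.
pose W k : set R := [set th | window (th + - (k%:~R * a))].
have mW k : measurable (W k) := measurable_preimage_shift (- (k%:~R * a)) measurable_window.
pose B (k : int) : set (measurableTypeR R * measurableTypeR R) :=
  ([set t | S (t + k%:~R)] `*` W k) `|`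
  (if b then [set t | S (t + (k%:~R + 4^-1))] `*` ~` W k else set0).
have -> : conf_map b a @^-1` misses S = ~` \bigcup_k B k.
  apply/seteqP; split => -[t th] /=.
    move=> mis [k _ []] /=; first move=> [St Wk].
      by apply: (mis _ St); rewrite pts_conf; exists k; left.
    case: ifP => // bb [/= St Wk]; apply: (mis _ St); rewrite pts_conf; exists k; right.
    by split => //; [rewrite addrA|exact/negP].
  move=> nB y Sy; rewrite pts_conf => -[k [[yE w]|[bb yE w]]]; apply: nB; exists k => //.
    by left; split => //=; rewrite -yE.
  by right; rewrite bb; split => /=; [rewrite addrA -yE|exact/negP].
apply: measurableC; apply: countable_bigcup_measurable => k; apply: measurableU.
  by apply: measurableX; [exact: (measurable_preimage_shift k%:~R mS)|exact: (mW k)].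
case: ifP => // _; apply: measurableX.
  exact: (measurable_preimage_shift (k%:~R + 4^-1) mS).
by apply: measurableC; exact: (mW k).
Qed.

HB.instance Definition _ b a :=
  isMeasurableFun.Build _ _ _ _ (conf_map b a) (measurable_conf_map b a).

Definition torus_unif : probability (measurableTypeR R * measurableTypeR R)%type R := (@unif R \x @unif R)%E.

Definition law b a : point_process_law R 1 := distribution torus_unif (conf_map b a).

Lemma lawE b a A : law b a A = torus_unif (conf_map b a @^-1` A).
Proof. by []. Qed.

Lemma torusE (A : set (measurableTypeR R * measurableTypeR R)) :
  torus_unif A = (\int[unif]_t unif [set th | A (t, th)])%E.
Proof.
rewrite /torus_unif /= /product_measure1; apply: eq_integral => t _ /=; congr (unif _).
by apply/seteqP; split => th; rewrite /xsection /= inE.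
Qed.

(** The measure of the section at phase [t] is 1-periodic in [t], as a unit of phase only rotates
    the angle; integrating over a period absorbs the translation. *)
Lemma law_stationary b a : stationary (law b a).
Proof.
move=> x A mA; rewrite !lawE.
set B := conf_map b a @^-1` A.
have mB : measurable B by rewrite -[B]setTI; exact: measurable_conf_map.
pose s := x ord0 ord0.
pose g t := unif [set th | B (t, th)].
have mg : measurable_fun setT g.
  have := measurable_fun_xsection (@unif R) mB; congr measurable_fun.
  apply/funext => t /=; congr (unif _).
  by apply/seteqP; split => th; rewrite /xsection /= inE.
have g1 t : g (t + 1) = g t.
  rewrite /g.
  have -> : [set th | B (t + 1, th)] = [set th | [set th | B (t, th)] (th + a)].
    apply/seteqP; split => th; rewrite /B /conf_map /=;
    by rewrite -[1]/(1%:~R) confD1 mul1r.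
  apply: unif_shift_set.
    have := measurable_xsection t mB; congr measurable.
    by apply/seteqP; split => th; rewrite /xsection /= inE.
  by move=> th; rewrite /B /conf_map /= -[1]/(1%:~R) conf_angleDz.
rewrite !torusE -[RHS](@unif_shift R g s)//.
apply: eq_integral => t _; rewrite /g; congr (unif _).
by apply/seteqP; split => th; rewrite /B /conf_map /= -(ptK x) conf_translate.
Qed.

Lemma law_invariant b a : liouville_like a -> invariant_on_hull (seed b a) (law b a).
Proof.
move=> la; split; last exact: law_stationary.
rewrite lawE -(probability_setT torus_unif); congr (torus_unif _).
by apply/seteqP; split => // w _; exact: conf_in_hull.
Qed.

Lemma law_associated b a : liouville_like a -> associated_point_process (seed b a) (law b a).
Proof.
move=> la; split; first exact: law_invariant.
by move=> Q Qinv; exact: (uniquely_ergodic la (law_invariant b la) Qinv).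
Qed.

End Law.

(** * Counting points of the members of the hull *)

Section FiniteCounting.
Import finmap.

Lemma counting_seq (R : realType) (T : choiceType) (l : seq T) : uniq l ->
  counting [set` l] = (size l)%:R%:E :> \bar R.
Proof.
move=> ul; rewrite /counting asboolT; last exact: finite_seq.
have -> : [set` l] = [set` seq_fset tt l].
  by apply/seteqP; split => x /=; have := seq_fsetE tt l x; rewrite /in_mem /= => ->.
by rewrite set_fsetK size_seq_fset undup_id.
Qed.

End FiniteCounting.

Section Counting.
Context {R : realType}.
Implicit Types (b : bool) (a t th y r : R).

Lemma euclidean_ball1 r : euclidean_ball r = line_set `[- r, r] :> set 'rV[R]_1.
Proof.
apply/seteqP; split => x; rewrite /euclidean_ball /line_set /= big_ord_recl big_ord0 addr0
  sqrtr_sqr in_itv /= ler_norml //.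
Qed.

Lemma counting_ball (F : closed_set R 1) r (l : seq R) : uniq l ->
  (forall y, y \in l <-> pts F y /\ - r <= y <= r) ->
  counting (carrier F `&` euclidean_ball r) = (size l)%:R%:E :> \bar R.
Proof.
move=> ul lE.
have up : uniq (map (@pt R) l).
  by rewrite map_inj_uniq// => y z /(congr1 (fun x : 'rV[R]_1 => x ord0 ord0)); rewrite !ptE.
have -> : carrier F `&` euclidean_ball r = [set` map (@pt R) l].
  rewrite euclidean_ball1; apply/seteqP; split => x /=.
    move=> [Fx]; rewrite /line_set /= in_itv /= => xr.
    by apply/mapP; exists (x ord0 ord0); rewrite ?ptK//; apply/lE; rewrite /pts /= ptK.
  by move=> /mapP[y /lE[Fy yr] ->]; split => //; rewrite line_set_pt /= in_itv.
by rewrite counting_seq// size_map.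
Qed.

(** Two closer points would be surrounded by disjoint small intervals, both hit by a translate of
    the seed, which has no points that close. *)
Lemma hull_gap b a (F : closed_set R 1) y y' : hull (seed b a) F -> pts F y -> pts F y' ->
  `|y - y'| < 3 / 4 -> y = y'.
Proof.
move=> hF; wlog yy' : y y' / y < y'.
  move=> H Fy Fy' yy'; have [lt|gt|//] := ltgtP y y'; first exact: H.
  by apply/esym; apply: H => //; rewrite distrC.
move=> Fy Fy' d; exfalso.
have {}d : y' - y < 3 / 4 by move: d; rewrite ltr0_norm ?subr_lt0// opprB.
pose e := Num.min (y' - y) (3 / 4 - (y' - y)) / 4.
have [e0 e1 e2] : [/\ 0 < e, 4 * e <= y' - y & 4 * e <= 3 / 4 - (y' - y)].
  have E : 4 * e = Num.min (y' - y) (3 / 4 - (y' - y)) by rewrite /e; field.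
  by split; rewrite ?E ?ge_min ?lexx ?orbT// divr_gt0// lt_min; apply/andP; split; lra.
pose B z : set R := `]z - e, z + e[%classic.
have zB z : B z z by rewrite /B /= in_itv /=; apply/andP; split; lra.
have oB z : open (B z) by exact: interval_open.
have [|t [/not_misses[z Bz Cz] /not_misses[z' Bz' Cz']]] :=
  hull_meet (openI (hits_open (oB y)) (hits_open (oB y'))) hF.
  by split; apply/not_misses; [exists y|exists y'].
rewrite pts_conf in Cz; rewrite pts_conf in Cz'.
move: Bz Bz'; rewrite /B /= !in_itv /= => /andP[z1 z2] /andP[z1' z2'].
have : z = z' by apply: site_gap Cz Cz' _; rewrite ltr_norml; apply/andP; split; lra.
lra.
Qed.

Definition half_ball r (i : int) : set R := [set y | Num.floor (2 * y) = i /\ - r <= y <= r].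

(** A half-open cell is a countable union of compact sets. *)
Lemma measurable_hit_half_ball r i :
  measurable (~` misses (half_ball r i) : set (fell_borel R 1)).
Proof.
pose K (n : nat) : set R := `[i%:~R / 2, (i + 1)%:~R / 2 - n.+1%:R^-1] `&` `[- r, r].
have -> : ~` misses (half_ball r i) = \bigcup_n ~` misses (K n).
  apply/seteqP; split => F.
    move=> /not_misses[y [yi yr] Fy].
    have /andP[f1 f2] := floor_itv (2 * y); rewrite yi in f1 f2.
    have g0 : 0 < (i + 1)%:~R / 2 - y by lra.
    exists (Num.truncn ((i + 1)%:~R / 2 - y)^-1) => //.
    apply/not_misses; exists y => //; rewrite /K; split => /=; rewrite in_itv //=.
    apply/andP; split; first lra.
    rewrite lerBrDr -lerBrDl ltW// -[X in _ < X]invrK ltf_pV2 ?posrE ?invr_gt0//.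
    by apply: truncnS_gt.
  move=> [n _ /not_misses[y []]]; rewrite /= !in_itv /= => /andP[y1 y2] yr Fy.
  apply/not_misses; exists y => //; split => //.
  have n0 : 0 < n.+1%:R^-1 :> R by rewrite invr_gt0.
  apply: floor_def; rewrite -ler_pdivrMl// -ltr_pdivlMl// ![2^-1 * _]mulrC y1 /=.
  by apply: (le_lt_trans y2); rewrite ltrBlDr ltrDl.
apply: bigcupT_measurable => n; apply: measurableC; apply: measurable_misses.
rewrite /K; apply: compact_closedI; first exact: segment_compact.
exact: interval_closed.
Qed.

Definition half_indices r : seq int :=
  let N := (Num.truncn (2 * `|r|)).+1 in [seq k%:Z - N%:Z | k <- iota 0 (N + N)].

Lemma half_indicesP r y : - r <= y <= r -> Num.floor (2 * y) \in half_indices r.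
Proof.
move=> yr; rewrite /half_indices; set N := (Num.truncn (2 * `|r|)).+1.
have NR : 2 * `|r| < N%:R by apply: truncnS_gt.
have := ler_norm r; have yr' : `|y| <= r by rewrite ler_norml.
have := ler_norm y; have := ler_norm (- y); rewrite normrN => h1 h2 h3.
have [i1 i2] : - N%:Z <= Num.floor (2 * y) /\ Num.floor (2 * y) < N%:Z.
  by rewrite floor_ge_int floor_lt_int mulrNz -pmulrn; split; lra.
apply/mapP; exists (absz (Num.floor (2 * y) + N%:Z)); last by rewrite gez0_abs ?addrK//; lia.
by rewrite mem_iota; lia.
Qed.

Lemma uniq_half_indices r : uniq (half_indices r).
Proof. by rewrite map_inj_uniq ?iota_uniq// => i j; lia. Qed.

(** A measurable substitute for the number of points in the ball: a half-open cell of length 1/2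
    holds at most one point of a member of the hull. *)
Definition hit_count r (F : fell_borel R 1) : R :=
  \sum_(i <- half_indices r) \1_(~` misses (half_ball r i)) F.

Lemma measurable_hit_count r : measurable_fun setT (hit_count r).
Proof.
apply: measurable_sum => i; apply: measurable_indic; exact: measurable_hit_half_ball.
Qed.

Lemma hull_count b a F r : hull (seed b a) F ->
  counting (carrier F `&` euclidean_ball r) = (hit_count r F)%:E.
Proof.
move=> hF.
have /choice[p pP] : forall i, exists y, (~` misses (half_ball r i)) F -> half_ball r i y /\ pts F y.
  move=> i; have [/not_misses[y yi Fy]|h] := pselect ((~` misses (half_ball r i)) F).
    by exists y.
  by exists 0.
pose J := [seq i <- half_indices r | `[< (~` misses (half_ball r i)) F >]].
rewrite (@counting_ball F r (map p J)).
- rewrite size_map size_filter /hit_count -sum1_count natr_sum big_mkcond /=.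
  congr EFin; apply: eq_bigr => i _; rewrite indicE.
  by case: asboolP => h; [rewrite mem_set|rewrite memNset].
- rewrite map_inj_in_uniq ?filter_uniq ?uniq_half_indices// => i j.
  rewrite !mem_filter => /andP[/asboolP /pP[[i1 _] _] _] /andP[/asboolP /pP[[j1 _] _] _] ij.
  by rewrite -i1 -j1 ij.
move=> y; split => [/mapP[i + ->]|[Fy yr]].
  by rewrite mem_filter => /andP[/asboolP /pP[[_ ?] ?] _].
pose i := Num.floor (2 * y).
have hi : (~` misses (half_ball r i)) F by apply/not_misses; exists y.
apply/mapP; exists i; first by rewrite mem_filter half_indicesP// andbT; exact/asboolP.
have [[pi pr] Fp] := pP _ hi.
apply: hull_gap hF Fy Fp _.
have /andP[f1 f2] := floor_itv (2 * y); have /andP[g1 g2] := floor_itv (2 * p i).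
rewrite pi -/i intrD in g1 g2; rewrite -/i intrD in f1 f2.
by rewrite ltr_norml; apply/andP; split; lra.
Qed.

Lemma ball_countE b a F r : hull (seed b a) F -> ball_count r F = hit_count r F.
Proof. by move=> hF; rewrite /ball_count (hull_count r hF). Qed.

End Counting.

(** * Moments of the point count *)

Section Moments.
Context {R : realType}.
Implicit Types (b : bool) (a t th y r : R).

Definition torus_count b a r (w : measurableTypeR R * measurableTypeR R) : R :=
  ball_count r (conf_map b a w).

Lemma torus_countE b a r : liouville_like a ->
  torus_count b a r = hit_count r \o conf_map b a.
Proof.
by move=> la; apply/funext => w; rewrite /torus_count (ball_countE r (conf_in_hull (b := b) (t := w.1) (th := w.2) la)).
Qed.

Lemma measurable_torus_count b a r : liouville_like a ->
  measurable_fun setT (torus_count b a r).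
Proof.
move=> la; rewrite torus_countE//.
exact: (measurableT_comp (measurable_hit_count r) (measurable_conf_map b a)).
Qed.

(** The law is carried by the hull, where the count agrees with a measurable function. *)
Lemma law_integral b a r (g : R -> R) : liouville_like a ->
  measurable_fun setT g -> (forall x, 0 <= g x) ->
  (\int[law b a]_F (g (ball_count r F))%:E = \int[torus_unif]_w (g (torus_count b a r w))%:E)%E.
Proof.
move=> la mg g0; have [lh _] := law_invariant b la.
have mh := measurable_hull (seed b a).
have g0' (x : R) : (0 <= (g x)%:E)%E by rewrite lee_fin.
transitivity (\int[law b a]_F (g (hit_count r F))%:E)%E.
  apply/eqP; rewrite eq_le; apply/andP; split;
    by apply: (ge0_le_integral_full mh lh) => // F hF; rewrite (ball_countE r hF).
rewrite (@ge0_integral_distribution _ _ _ _ R torus_unif (conf_map b a) (fun F => (g (hit_count r F))%:E))//.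
  by apply: eq_integral => w _; rewrite torus_countE.
apply/measurable_EFinP.
exact: (measurableT_comp mg (measurable_hit_count r)).
Qed.

Lemma ball_count_ge0 r (F : fell_borel R 1) : 0 <= ball_count r F.
Proof.
rewrite /ball_count /counting; case: ifP => _ //=.
Qed.

Definition mean_count b a r : R := fine (\int[torus_unif]_w (torus_count b a r w)%:E)%E.

Lemma law_variance b a r : liouville_like a ->
  'V_(law b a)[ball_count r] =
  (\int[torus_unif]_w ((torus_count b a r w - mean_count b a r) ^+ 2)%:E)%E.
Proof.
move=> la; rewrite /variance unlock.
have -> : fine 'E_(law b a)[ball_count r] = mean_count b a r.
  rewrite unlock /mean_count; congr fine.
  (* counts are nonnegative, so the test function may be replaced by a nonnegative one *)
  have maxE (x : R) : 0 <= x -> Num.max x 0 = x by move=> /max_l.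
  transitivity (\int[law b a]_F (Num.max (ball_count r F) 0)%:E)%E.
    by apply: eq_integral => F _; rewrite maxE ?ball_count_ge0.
  rewrite (@law_integral b a r (fun x => Num.max x 0) la).
  - by apply: eq_integral => w _; rewrite maxE ?ball_count_ge0.
  - by apply: measurable_maxr; [exact: measurable_id|exact: measurable_cst].
  - by move=> x; rewrite le_max lexx orbT.
rewrite unlock.
apply: (@law_integral b a r (fun x => (x - mean_count b a r) ^+ 2)) => //; last first.
  by move=> x; rewrite sqr_ge0.
apply: measurable_funX; apply: measurable_funB; [exact: measurable_id|exact: measurable_cst].
Qed.

Lemma size_half_count r (F : fell_borel R 1) : hit_count r F <= (size (half_indices r))%:R.
Proof.
rewrite /hit_count -sum1_size natr_sum; apply: ler_sum => i _.
by rewrite indicE; case: (_ \in _).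
Qed.

Lemma law_square_integrable b a : liouville_like a -> locally_square_integrable (law b a).
Proof.
move=> la K cK; have [B BK] := compact_coord_bounded cK.
have [lh _] := law_invariant b la.
set N : R := (size (half_indices (B%:R : R)))%:R.
apply: (@le_lt_trans _ _ (\int[law b a]_F (N ^+ 2)%:E)%E); last first.
  by rewrite integral_cst_prob ltry.
apply: (ge0_le_integral_full (measurable_hull (seed b a)) lh).
- move=> F; rewrite expe_ge0// /counting; case: ifP => _; rewrite ?lee_fin//.
- by move=> F; rewrite lee_fin sqr_ge0.
move=> F hF.
have hE := hull_count B%:R hF.
have FK : F `&` K `<=` F `&` euclidean_ball B%:R.
  move=> x [Fx Kx]; split => //; rewrite euclidean_ball1 /line_set /= in_itv /= -ler_norml.
  by apply: BK; rewrite ptK.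
move: hE; rewrite /counting; case: asboolP => // fin [hE].
have finK : finite_set (F `&` K) by exact: sub_finite_set fin.
rewrite asboolT// -EFin_expe lee_fin ler_pXn2r ?nnegrE//.
apply: le_trans (size_half_count B%:R F); rewrite -hE ler_nat.
apply: finmap.fsubset_leq_card; by rewrite -fset_set_sub.
Qed.

Definition irange (A : int) (n : nat) : seq int := [seq A + k%:Z | k <- iota 0 n].

Lemma mem_irange A n (k : int) : (k \in irange A n) = (A <= k < A + n%:Z).
Proof.
apply/mapP/idP => [[j + ->]|kA]; first by rewrite mem_iota; lia.
by exists (absz (k - A)); [rewrite mem_iota; lia|rewrite gez0_abs ?subrKC//; lia].
Qed.

Lemma uniq_irange A n : uniq (irange A n).
Proof. by rewrite map_inj_uniq ?iota_uniq// => i j; lia. Qed.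

Lemma ball_count_seq (F : closed_set R 1) r (l : seq R) : uniq l ->
  (forall y, y \in l <-> pts F y /\ - r <= y <= r) -> ball_count r F = (size l)%:R.
Proof. by move=> ul lE; rewrite /ball_count (counting_ball ul lE). Qed.

(** Every unit cell holds one point, so only the cells at the two ends of the interval are in
    doubt. *)
Lemma ball_count_union a t th r : 1 <= r -> `|ball_count r (conf true a t th) - 2 * r| <= 2.
Proof.
move=> r1.
pose p (k : int) : R := t + k%:~R + (if window (th - k%:~R * a) then 0 else 4^-1).
have pk (k : int) : t + k%:~R <= p k <= t + k%:~R + 4^-1.
  by rewrite /p; case: ifP => _; apply/andP; split; lra.
have pI : injective p.
  move=> k l kl; have /andP[k1 k2] := pk k; have /andP[l1 l2] := pk l.
  have : (k - l)%:~R < 1%:~R :> R by rewrite intrB; lra.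
  have : (-1)%:~R < (k - l)%:~R :> R by rewrite intrB mulrNz; lra.
  by rewrite !ltr_int; lia.
pose A' := Num.ceil (- r - t - 4^-1); pose B' := Num.floor (r - t).
pose A := Num.ceil (- r - t); pose B := Num.floor (r - t - 4^-1).
have /andP[A1 A2] := ceil_itv (- r - t); have /andP[B1 B2] := floor_itv (r - t - 4^-1).
have /andP[A1' A2'] := ceil_itv (- r - t - 4^-1); have /andP[B1' B2'] := floor_itv (r - t).
rewrite -/A -/B -/A' -/B' !intrB !intrD in A1 A2 B1 B2 A1' A2' B1' B2'.
have AB : A <= B + 1.
  by rewrite -(ler_int R) intrD; lra.
have AB' : A' <= B' + 1.
  by rewrite -(ler_int R) intrD; lra.
pose n := absz (B - A + 1); pose n' := absz (B' - A' + 1).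
have nZ : A + n%:Z = B + 1 by rewrite gez0_abs; [ring|rewrite addrAC subr_ge0].
have nZ' : A' + n'%:Z = B' + 1 by rewrite gez0_abs; [ring|rewrite addrAC subr_ge0].
have nE : n%:R = B%:~R - A%:~R + 1 :> R.
  by move/(congr1 (fun i : int => i%:~R : R)): nZ; rewrite !intrD -pmulrn; lra.
have nE' : n'%:R = B'%:~R - A'%:~R + 1 :> R.
  by move/(congr1 (fun i : int => i%:~R : R)): nZ'; rewrite !intrD -pmulrn; lra.
pose ks := [seq k <- irange A' n' | - r <= p k <= r].
rewrite (@ball_count_seq _ r (map p ks)); first last.
- move=> y; rewrite pts_conf; split.
    move=> /mapP[k]; rewrite mem_filter => /andP[kr _] ->; split => //.
    exists k; rewrite /p; case: ifP => w; [left|right]; rewrite ?addr0//.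
  move=> [[k kP] yr].
  have yE : y = p k.
    by rewrite /p; case: kP => [[-> ->]|[_ -> /negbTE ->]] //; rewrite addr0.
  apply/mapP; exists k => //; rewrite mem_filter -yE yr /= mem_irange.
  have /andP[k1 k2] := pk k; rewrite -yE in k1 k2; case/andP: yr => y1 y2.
  have A'k : A' <= k by rewrite -ltzD1 -(ltr_int R) intrD; lra.
  have kB' : k <= B' by rewrite -ltzD1 -(ltr_int R) intrD; lra.
  by rewrite nZ' ltzD1 A'k.
- by rewrite map_inj_uniq// filter_uniq// uniq_irange.
rewrite size_map.
have up : (size ks <= n')%N.
  by rewrite (leq_trans (size_subseq (filter_subseq _ _)))// size_map size_iota.
have lo : (n <= size ks)%N.
  have -> : n = size (irange A n) by rewrite size_map size_iota.
  apply: uniq_leq_size; first exact: uniq_irange.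
  move=> k; rewrite mem_irange => /andP[kA kB]; rewrite mem_filter mem_irange.
  have kB2 : k <= B by rewrite -ltzD1 -nZ.
  have kA1 : A%:~R <= k%:~R :> R by rewrite ler_int.
  have kB1 : k%:~R <= B%:~R :> R by rewrite ler_int.
  have /andP[k1 k2] := pk k.
  have A'k : A' <= k by rewrite -ltzD1 -(ltr_int R) intrD; lra.
  have kB' : k <= B' by rewrite -ltzD1 -(ltr_int R) intrD; lra.
  rewrite nZ' ltzD1 A'k kB' !andbT.
  by apply/andP; split; lra.
have up' : (size ks)%:R <= n'%:R :> R by rewrite ler_nat.
have lo' : n%:R <= (size ks)%:R :> R by rewrite ler_nat.
by rewrite ler_norml; apply/andP; split; lra.
Qed.

(** For a phase below 1/2 the interval of radius [M + 1/2] contains the sites of the cells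
    [- M, .., M] and no others, so that the count is exactly a sum along the orbit. *)
Lemma ball_count_orbit a t th (M : nat) : 0 <= t -> t < 2^-1 ->
  ball_count (M%:R + 2^-1) (conf false a t th) =
  (orbit_sum a (2 * M).+1 (th - M%:R * a))%:R.
Proof.
move=> t0 t1.
pose w (k : nat) := window (th - M%:R * a + k%:R * a).
pose p (k : nat) : R := t + (M%:R - k%:R).
have wE (k : nat) : w k = window (th - (M%:Z - k%:Z)%:~R * a).
  by congr window; rewrite intrB -!pmulrn; ring.
rewrite (@ball_count_seq _ _ [seq p k | k <- iota 0 (2 * M).+1 & w k]).
- rewrite size_map size_filter -sum1_count /orbit_sum big_mkcond.
  congr (_%:R); rewrite -[iota _ _]/(index_iota 0 (2 * M).+1) big_mkord.
  by apply: eq_bigr => k _; rewrite /w; case: window.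
- rewrite map_inj_uniq ?filter_uniq ?iota_uniq//.
  by move=> i j /addrI/addrI/oppr_inj/eqP; rewrite eqr_nat => /eqP.
move=> y; rewrite pts_conf; split.
  move=> /mapP[k]; rewrite mem_filter mem_iota => /andP[wk /andP[_ kM]] ->; split.
    by exists (M%:Z - k%:Z); left; rewrite -wE intrB -!pmulrn.
  have : k%:R <= 2 * M%:R :> R by rewrite -natrM ler_nat; lia.
  by have : 0 <= k%:R :> R by []; rewrite /p => ? ?; apply/andP; split; lra.
move=> [[k [[yE wk]|[]//]] /andP[y1 y2]].
have k1 : k < M%:Z + 1.
  by rewrite -(ltr_int R) intrD -pmulrn; lra.
have k2 : - M%:Z - 1 < k.
  by rewrite -(ltr_int R) intrB mulrNz -pmulrn; lra.
apply/mapP; exists (absz (M%:Z - k)).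
  by rewrite mem_filter wE gez0_abs ?mem_iota ?subKr ?wk; lia.
by rewrite /p yE (pmulrn 1 (absz _)) gez0_abs ?intrB -?pmulrn; [ring|lia].
Qed.

End Moments.

(** * Hyperuniformity of the union *)

Section Hyperuniformity.
Context {R : realType}.
Implicit Types (b : bool) (a t th y r : R).

Lemma mean_count_union a r : liouville_like a -> 1 <= r ->
  `|mean_count true a r - 2 * r| <= 2.
Proof.
move=> la r1.
have cw w : 2 * r - 2 <= torus_count true a r w <= 2 * r + 2.
  have := ball_count_union a w.1 w.2 r1.
  by rewrite -/(torus_count true a r w) ler_norml => /andP[? ?]; apply/andP; split; lra.
have c0 w : (0 <= (torus_count true a r w)%:E)%E by rewrite lee_fin; exact: ball_count_ge0.
have mc := measurable_torus_count true r la.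
have mc' : measurable_fun setT (fun w => (torus_count true a r w)%:E) by exact/measurable_EFinP.
rewrite /mean_count; set I := (\int[_]_w _)%E.
have I1 : ((2 * r - 2)%:E <= I)%E.
  rewrite -(integral_cst_prob torus_unif); apply: ge0_le_integral => //.
    by move=> x _; rewrite lee_fin; lra.
  by move=> w _; rewrite lee_fin; have /andP[] := cw w.
have I2 : (I <= (2 * r + 2)%:E)%E.
  rewrite -(integral_cst_prob torus_unif); apply: ge0_le_integral => //.
  by move=> w _; rewrite lee_fin; have /andP[] := cw w.
have Ifin : I \is a fin_num.
  by rewrite fin_numE; move: I1 I2; case: I.
move: I1 I2; rewrite -(fineK Ifin) !lee_fin => I1 I2.
by rewrite ler_norml; apply/andP; split; lra.
Qed.

(** The count stays within a bounded distance of [2 r], so its variance is bounded. *)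
Lemma union_hyperuniform a : liouville_like a -> hyperuniform (law true a).
Proof.
move=> la; rewrite /hyperuniform.
have V0 r : (0 <= 'V_(law true a)[ball_count r])%E by exact: variance_ge0.
have V1 r : 1 <= r -> ('V_(law true a)[ball_count r] <= 16%:E)%E.
  move=> r1; rewrite law_variance// -(integral_cst_prob torus_unif).
  have mc := measurable_torus_count true r la.
  apply: ge0_le_integral => //.
  - by move=> w _; rewrite lee_fin sqr_ge0.
  - apply/measurable_EFinP; by apply: measurable_funX; apply: measurable_funB; [exact: mc|exact: measurable_cst].
  - move=> w _; rewrite lee_fin -[leLHS]ger0_norm ?sqr_ge0// normrX.
    have -> : 16 = 4 ^+ 2 :> R by rewrite expr2; lra.
    rewrite ler_pXn2r ?nnegrE//.
    have := mean_count_union la r1; have := ball_count_union a w.1 w.2 r1.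
    rewrite -/(torus_count true a r w) !ler_norml => /andP[? ?] /andP[? ?].
    by apply/andP; split; lra.
have z0 : (fun _ : R => (0 : \bar R)%E) @ +oo%R --> (0 : \bar R)%E by apply: cvg_cst.
have vinv : (fun r : R => r^-1) @ +oo%R --> (0 : R).
  apply/(@gtr0_cvgV0 R R _ _ id); last exact: cvg_id.
  exact: nbhs_pinfty_gt.
have inv0 : (fun r : R => (16 * r^-1)%:E) @ +oo%R --> (0 : \bar R)%E.
  apply: cvg_EFin; first by apply: nearW.
  by rewrite -[X in _ --> X](mulr0 16); apply: cvgMr.
apply: (squeeze_cvge _ z0 inv0).
near=> r.
have r1 : 1 <= r by near: r; exact: nbhs_pinfty_ge.
have ri : 0 <= r ^- 1 by rewrite invr_ge0 expr1; lra.
apply/andP; split; first by rewrite mule_ge0.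
by rewrite EFinM lee_wpmul2r ?lee_fin// V1.
Unshelve. all: end_near. Qed.

End Hyperuniformity.

(** * Large variance of the first point set *)

Section LowerBound.
Context {R : realType}.
Implicit Types (b : bool) (a t th y r : R).
Local Notation mu := (@lebesgue_measure R).

Lemma unif_restrict (A : set R) : measurable A -> unif A = mu (A `&` `[0, 1[).
Proof.
move=> mA; have : unif A = (\int[unif]_x (\1_A x)%:E)%E by rewrite integral_indic// setIT.
move=> ->; rewrite unifE//; first by rewrite integral_indic.
exact/measurable_EFinP/measurable_indic.
Qed.

Definition window_jump e : set R := [set y | window (y + e) != window y].

Lemma measurable_window_jump e : measurable (window_jump e).
Proof.
have -> : window_jump e = ([set y | window (y + e)] `\` [set y | window y]) `|`
    ([set y | window y] `\` [set y | window (y + e)]).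
  apply/seteqP; split => y; rewrite /window_jump /=.
    by case: (window (y + e)); case: (window y) => // _; [left|right].
  by move=> [[-> /negP/negbTE ->]|[-> /negP/negbTE ->]].
have m1 := @measurable_window R.
have m2 := measurable_preimage_shift e m1.
by apply: measurableU; apply: measurableD; [exact: m2|exact: m1|exact: m1|exact: m2].
Qed.

Lemma window_jump_periodic e y : window_jump e (y + 1) <-> window_jump e y.
Proof.
rewrite /window_jump /=.
have -> : y + 1 + e = y + e + 1%:~R by rewrite addrAC.
by rewrite windowDz [window (y + 1)](windowDz y 1).
Qed.

(** The value changes only in the intervals of length [e] to the left of 1/2 and of 1. *)
Lemma unif_window_jump e : 0 <= e -> e <= 2^-1 -> (unif (window_jump e) <= (2 * e)%:E)%E.
Proof.
move=> e0 e1; rewrite unif_restrict; last exact: measurable_window_jump.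
have mI (x : R) : measurable (`[x - e, x] : set R) by exact: measurable_itv.
have mm : measurable (`[2^-1 - e, 2^-1] `|` `[1 - e, 1] : set R) by exact: measurableU.
have muI (x : R) : (mu `[(x - e)%R, x] <= e%:E)%E.
  rewrite lebesgue_measure_itv /= lte_fin; case: ifP => _; last by rewrite lee_fin.
  by rewrite -EFinB lee_fin; lra.
apply: (@le_trans _ _ (mu (`[2^-1 - e, 2^-1] `|` `[1 - e, 1]))).
  apply: le_measure; rewrite ?inE//.
    by apply: measurableI; [exact: measurable_window_jump|exact: measurable_itv].
  move=> y [jy]; rewrite /= !in_itv /= => /andP[y0 y1].
  have [yh|yh] := ltP y 2^-1.
    left; apply/andP; split; last lra.
    rewrite leNgt; apply/negP => yl; move: jy; rewrite /window_jump /=.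
    by rewrite !window_itv ?eqxx//; apply/andP; split; lra.
  right; apply/andP; split; last lra.
  rewrite leNgt; apply/negP => yl; move: jy; rewrite /window_jump /=.
  have /negbTE -> : ~~ window y by apply: nwindow_itv; rewrite yh y1.
  have /negbTE -> : ~~ window (y + e) by apply: nwindow_itv; apply/andP; split; lra.
  by [].
apply: (le_trans (measureU2 mu (mI 2^-1) (mI 1))).
have -> : (2 * e)%:E = (e%:E + e%:E)%E by rewrite -EFinD; congr EFin; lra.
by apply: leeD; exact: muI.
Qed.

Lemma measure_bigsetU_le d (T : measurableType d) (P : probability T R) (n : nat) (B : nat -> set T) (c : R) :
  (forall i, (i < n)%N -> measurable (B i)) -> (forall i, (i < n)%N -> (P (B i) <= c%:E)%E) ->
  measurable (\big[setU/set0]_(i < n) B i) /\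
  (P (\big[setU/set0]_(i < n) B i) <= (n%:R * c)%:E)%E.
Proof.
elim: n => [|n IH] mB PB; first by rewrite big_ord0 measure0 mul0r.
have [|i ni|m1 P1] := IH; [by move=> i ni; apply: mB; lia|by apply: PB; lia|].
rewrite big_ord_recr /=; have mn : measurable (B n) by apply: mB.
split; first exact: measurableU.
apply: le_trans (measureU2 _ m1 mn) _.
have -> : (n.+1%:R * c)%:E = ((n%:R * c)%:E + c%:E)%E by rewrite -EFinD -natr1; congr EFin; ring.
by apply: leeD => //; apply: PB.
Qed.

Lemma orbit_sum_periodic a N y : orbit_sum a N (y + 1) = orbit_sum a N y.
Proof.
apply: eq_bigr => n _; congr nat_of_bool.
by rewrite addrAC -[X in _ + X]/(1%:~R) windowDz.
Qed.

Lemma measurable_orbit_sum a N : measurable_fun setT (fun y => (orbit_sum a N y)%:R : R).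
Proof.
rewrite /orbit_sum; under eq_fun do rewrite natr_sum.
apply: measurable_sum => n.
have -> : (fun y => (window (y + n%:R * a))%:R : R) = \1_[set y | window (y + n%:R * a)].
  apply/funext => y; rewrite indicE; congr (nat_of_bool _)%:R.
  by apply/idP/idP => [w|]; rewrite ?inE//; exact: mem_set.
apply: measurable_indic.
exact: (measurable_preimage_shift (n%:R * a) measurable_window).
Qed.

Lemma integral_scaled_indic d (T : measurableType d) (P : probability T R) (k : R) (A : set T) :
  0 <= k -> measurable A -> (\int[P]_x (k%:E * (\1_A x)%:E) = k%:E * P A)%E.
Proof.
move=> k0 mA; rewrite ge0_integralZl//.
- by rewrite integral_indic// setIT.
- exact/measurable_EFinP/measurable_indic.
Qed.

(** An angle is discarded when at some step [n < q ^ 2] a multiple of 1/2 separates the two orbits.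
    For each [n] this has probability at most [2 q ^ 2 d], where [d = a - p / q], so in total at
    most [2 q ^ 4 d <= 1/4] for each of the two starting points. *)
Lemma shadowing_angles a q (p : nat) : approximant a q p ->
  8 * q%:R ^+ 4 * (a - p%:R / q%:R) <= 1 ->
  exists G : set R, [/\ measurable G, ((2^-1)%:E <= unif G)%E &
   forall y, G y -> forall n : nat, (n < q * q)%N ->
     window (y + n%:R * a) = window (y + n%:R * (p%:R / q%:R)) /\
     window (y + (2 * q%:R)^-1 + n%:R * a) = window (y + (2 * q%:R)^-1 + n%:R * (p%:R / q%:R))].
Proof.
move=> apq key; have [q0 _ d0 _] := apq; rewrite -pmulrn in d0.
set d := a - _ in d0 key.
set N := (q * q)%N.
have NE : N%:R = q%:R * q%:R :> R by rewrite natrM.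
have q1 : 1 <= q%:R :> R by rewrite ler1n.
pose B0 (c : R) (n : nat) : set R := [set y | window_jump (n%:R * d) (y + (c + n%:R * (p%:R / q%:R)))].
have mB0 c n : measurable (B0 c n).
  exact: (measurable_preimage_shift _ (measurable_window_jump (n%:R * d))).
have nd n : (n < N)%N -> 0 <= n%:R * d /\ 8 * (N%:R * (n%:R * d)) <= 1.
  move=> nN; split; first by rewrite mulr_ge0.
  apply: le_trans key; rewrite -[leRHS]mulrA ler_wpM2l//.
  have -> : q%:R ^+ 4 * d = N%:R * (N%:R * d) by rewrite NE !exprS expr0; ring.
  by rewrite ler_wpM2l// ler_wpM2r// ler_nat ltnW.
have N1 : 1 <= N%:R :> R by rewrite ler1n muln_gt0 q0.
have uB0 c n : (n < N)%N -> (unif (B0 c n) <= ((4 * N%:R)^-1)%:E)%E.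
  move=> nN; have [n0 n8] := nd n nN.
  have n2 : n%:R * d <= 2^-1.
    have : n%:R * d <= N%:R * (n%:R * d) by rewrite ler_peMl.
    by lra.
  rewrite /B0 unif_shift_set; [|exact: measurable_window_jump|exact: window_jump_periodic].
  apply: le_trans (unif_window_jump n0 n2) _.
  rewrite lee_fin -[leRHS]mul1r ler_pdivlMr ?mulr_gt0//; last by lra.
  by lra.
have [m1 P1] := @measure_bigsetU_le _ _ (@unif R) N (B0 0) (4 * N%:R)^-1 (fun i _ => mB0 0 i) (uB0 0).
have [m2 P2] := @measure_bigsetU_le _ _ (@unif R) N (B0 (2 * q%:R)^-1) (4 * N%:R)^-1
  (fun i _ => mB0 (2 * q%:R)^-1 i) (uB0 (2 * q%:R)^-1).
have NN : N%:R * (4 * N%:R)^-1 = 4^-1 :> R by field; lra.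
rewrite NN in P1 P2.
pose bad := (\big[setU/set0]_(i < N) B0 0 i) `|` (\big[setU/set0]_(i < N) B0 (2 * q%:R)^-1 i).
have mbad : measurable bad by exact: measurableU.
exists (~` bad); split; first exact: measurableC.
  rewrite probability_setC//.
  have ub : (unif bad <= (2^-1)%:E)%E.
    apply: le_trans (measureU2 _ m1 m2) _.
    have -> : (2^-1)%:E = ((4^-1)%:E + (4^-1)%:E)%E :> \bar R by rewrite -EFinD; congr EFin; lra.
    exact: leeD.
  have ufin : unif bad \is a fin_num by exact: fin_num_measure.
  by move: ub; rewrite -(fineK ufin) lee_fin -EFinB lee_fin => ub; lra.
move=> y nby n nN.
have jump c : ~ B0 c n y -> window (y + c + n%:R * a) = window (y + c + n%:R * (p%:R / q%:R)).
  rewrite /B0 /window_jump /= => /negP; rewrite negbK => /eqP.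
  have -> : y + (c + n%:R * (p%:R / q%:R)) + n%:R * d = y + c + n%:R * a by rewrite /d; ring.
  by rewrite addrA.
split.
  have := @jump 0; rewrite addr0; apply => By; apply: nby; left.
  by rewrite -bigcup_mkord; exists n.
by apply: jump => By; apply: nby; right; rewrite -bigcup_mkord; exists n.
Qed.

(** The rotation by [1 / (2 q)] preserves the uniform law, so twice the integral is that of
    [(A - m) ^ 2 + (B - m) ^ 2 >= (A - B) ^ 2 / 2], where the sums [A] at [y] and [B] at
    [y + 1 / (2 q)] differ by at least [q] for half of the angles. *)
Lemma orbit_sum_variance a q (p : nat) (m : R) : odd q -> approximant a q p ->
  8 * q%:R ^+ 4 * (a - p%:R / q%:R) <= 1 ->
  ((q%:R ^+ 2 / 8)%:E <= \int[unif]_y (((orbit_sum a (q * q) y)%:R - m) ^+ 2)%:E)%E.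
Proof.
move=> oq apq key; have [G [mG uG GP]] := shadowing_angles apq key.
have [q0 cpq _ _] := apq.
pose h y := ((orbit_sum a (q * q) y)%:R - m) ^+ 2.
have h0 y : (0 <= (h y)%:E)%E by rewrite lee_fin sqr_ge0.
have mh : measurable_fun setT (fun y => (h y)%:E).
  apply/measurable_EFinP; apply: measurable_funX; apply: measurable_funB.
    exact: measurable_orbit_sum.
  exact: measurable_cst.
pose c : R := (2 * q%:R)^-1.
have mhc : measurable_fun setT (fun y : R => (h (y + c))%:E).
  exact: (measurableT_comp mh (measurable_shift c)).
rewrite -/(h _); set I := (\int[_]_y _)%E.
have Ic : (\int[unif]_y (h (y + c)%R)%:E = I)%E.
  apply: (@unif_shift R (fun y => (h y)%:E)) => // x.
  by rewrite /h orbit_sum_periodic.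
have II : (\int[unif]_y ((h y)%:E + (h (y + c)%R)%:E) = I + I)%E.
  by rewrite ge0_integralD// Ic.
have q2 : 0 <= q%:R ^+ 2 / 2 :> R by rewrite divr_ge0.
have lower : ((q%:R ^+ 2 / 4)%:E <= I + I)%E.
  rewrite -II.
  apply: (@le_trans _ _ (\int[unif]_y ((q%:R ^+ 2 / 2)%:E * (\1_G y)%:E)))%E.
    rewrite integral_scaled_indic//.
    have -> : (q%:R ^+ 2 / 4)%:E = ((q%:R ^+ 2 / 2)%:E * (2^-1)%:E)%E :> \bar R.
      by rewrite -EFinM; congr EFin; field.
    by rewrite lee_wpmul2l// lee_fin.
  apply: ge0_le_integral => //.
  - by apply: emeasurable_funM => //; exact/measurable_EFinP/measurable_indic.
  - by apply: emeasurable_funD.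
  move=> y _; rewrite -EFinM -EFinD lee_fin indicE.
  have [/set_mem Gy|_] := boolP (y \in G); last by rewrite mulr0 addr_ge0// sqr_ge0.
  rewrite mulr1.
  have := @long_sum_jump R a q p y oq cpq; rewrite -pmulrn => /(_ (GP y Gy)).
  rewrite -(ler_int R) intr_norm intrB -!pmulrn -/c /h => jump.
  move: jump; set A := (orbit_sum a _ y)%:R; set B := (orbit_sum a _ (y + c))%:R => jump.
  have : q%:R ^+ 2 <= (A - B) ^+ 2.
    by rewrite -[leRHS]ger0_norm ?sqr_ge0// normrX ler_pXn2r ?nnegrE.
  (* 2 (A - m)^2 + 2 (B - m)^2 = (A - B)^2 + (A + B - 2 m)^2 *)
  have := sqr_ge0 (A + B - 2 * m).
  rewrite !expr2; lra.
clear II Ic; clearbody I; case: I lower => [x| |]; [|by move=> _; rewrite leey|by []].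
by rewrite -EFinD !lee_fin; lra.
Qed.

Lemma seed_variance_ge a q (p : nat) (M : nat) : liouville_like a -> odd q -> approximant a q p ->
  8 * q%:R ^+ 4 * (a - p%:R / q%:R) <= 1 -> (2 * M).+1 = (q * q)%N ->
  ((q%:R ^+ 2 / 16)%:E <= 'V_(law false a)[ball_count (M%:R + 2^-1)])%E.
Proof.
move=> la oq apq key MN; rewrite law_variance//.
set m := mean_count _ _ _.
pose h y : R := ((orbit_sum a (q * q) y)%:R - m) ^+ 2.
have h0 y : 0 <= h y by rewrite sqr_ge0.
have mh : measurable_fun setT h.
  apply: measurable_funX; apply: measurable_funB; first exact: measurable_orbit_sum.
  exact: measurable_cst.
have mhs : measurable_fun setT (fun th : R => h (th - M%:R * a)).
  exact: (measurableT_comp mh (measurable_shift (- (M%:R * a)))).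
have mhalf : measurable (`[0, 2^-1[ : set R) by exact: measurable_itv.
pose g (w : measurableTypeR R * measurableTypeR R) : \bar R :=
  (\1_(`[0%R, 2^-1%R[ : set R) w.1 * h (w.2 - M%:R * a)%R)%:E.
have mg : measurable_fun setT g.
  apply/measurable_EFinP; apply: measurable_funM.
    exact: (measurableT_comp (measurable_indic mhalf) measurable_fst).
  exact: (measurableT_comp mhs measurable_snd).
have g0 w : (0 <= g w)%E by rewrite lee_fin mulr_ge0.
apply: (@le_trans _ _ (\int[torus_unif]_w g w)%E); last first.
  have mc := measurable_torus_count false (M%:R + 2^-1) la.
  apply: ge0_le_integral => //.
    apply/measurable_EFinP; apply: measurable_funX; apply: measurable_funB; [exact: mc|exact: measurable_cst].
  move=> w _; rewrite lee_fin indicE.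
  have [/set_mem|_] := boolP (w.1 \in _); last by rewrite mul0r sqr_ge0.
  rewrite /= in_itv /= => /andP[w0 w1].
  by rewrite mul1r /torus_count /conf_map ball_count_orbit// MN.
rewrite /torus_unif (@fubini_tonelli1 _ _ _ _ _ (@unif R) (@unif R) g)//.
rewrite /fubini_F.
apply: (@le_trans _ _ (\int[unif]_t ((q%:R ^+ 2 / 8)%:E * (\1_(`[0%R, 2^-1%R[ : set R) t)%:E)))%E.
  rewrite integral_scaled_indic ?divr_ge0// unif_restrict//.
  have -> : (`[0, 2^-1[%classic `&` `[0, 1[%classic : set R) = `[0, 2^-1[%classic.
    apply/seteqP; split => x /=; rewrite !in_itv /=; first by case.
    by move=> /andP[x0 x1]; split; apply/andP; split; lra.
  rewrite lebesgue_measure_itv /= lte_fin invr_gt0 ltr0n /= -EFinB subr0 -EFinM lee_fin.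
  by have : 0 <= q%:R ^+ 2 :> R by []; lra.
apply: ge0_le_integral => //.
- by apply: emeasurable_funM => //; exact/measurable_EFinP/measurable_indic.
- exact: measurable_fun_fubini_tonelli_F.
move=> t _; rewrite /g /=.
have [tI|tI] := boolP (t \in (`[0, 2^-1[%classic : set R)); rewrite indicE ?tI ?(negbTE tI).
  under eq_integral do rewrite mul1r.
  rewrite mule1 (@unif_shift R (fun y => (h y)%:E) (- (M%:R * a)))//.
  - exact: (orbit_sum_variance m oq apq key).
  - exact/measurable_EFinP.
  - by move=> x; rewrite /h orbit_sum_periodic.
by under eq_integral do rewrite mul0r; rewrite mule0 integral0.
Qed.

(** For the radius [q ^ 2 / 2] the variance is at least [q ^ 2 / 16], an eighth of the radius. *)
Lemma seed_not_hyperuniform a : liouville_like a -> ~ hyperuniform (law false a).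
Proof.
move=> la hyp.
have /hyp[A [Areal AP]] : nbhs (0 : \bar R) [set x | (x < (8^-1)%:E)%E].
  by apply: open_nbhs_nbhs; split; [exact: open_ereal_lt_ereal|rewrite /= lte_fin].
have [q [p [Qq oq apq key]]] := la (Num.truncn (Num.max A 0%R) + 2)%N.
pose M := ((q * q)./2)%N.
have MN : (2 * M).+1 = (q * q)%N.
  have := odd_double_half (q * q); rewrite oddM oq /= /M => <-; rewrite -mul2n; lia.
pose r : R := M%:R + 2^-1.
have rE : r = q%:R ^+ 2 / 2.
  have : (2 * M).+1%:R = (q * q)%N%:R :> R by rewrite MN.
  by rewrite -natr1 natrM natrM expr2 /r => E; lra.
have q2 : 2 <= q%:R :> R by rewrite ler_nat; lia.
have r0 : 0 < r by rewrite rE divr_gt0// exprn_gt0//; lra.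
have Ar : A < r.
  apply: (@le_lt_trans _ _ (Num.max A 0)); first by rewrite le_max lexx.
  apply: (lt_le_trans (truncnS_gt _)).
  apply: (@le_trans _ _ q%:R); first by rewrite ler_nat (leq_trans _ Qq)// addn2.
  by rewrite rE ler_pdivlMr// expr2 ler_wpM2l//; lra.
have := AP r Ar; apply/negP; rewrite -leNgt.
have V := seed_variance_ge la oq apq key MN.
have -> : (8^-1)%:E = ((q%:R ^+ 2 / 16)%:E * (r ^- 1)%:E)%E :> \bar R.
  by rewrite -EFinM; congr EFin; rewrite rE expr1; field; lra.
by rewrite lee_wpmul2r// lee_fin invr_ge0 ltW.
Qed.

End LowerBound.

(** * Local derivability and finite local complexity *)

Section LocalDerivability.
Context {R : realType}.
Implicit Types (b : bool) (a t th y : R) (S : set R).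

Lemma translateN_line_set S (x z : 'rV[R]_1) :
  translate (- x) (line_set S) z <-> S (x ord0 ord0 + z ord0 ord0).
Proof.
rewrite /translate /=; split=> [[w Sw <-]|Sz].
  by move: Sw; rewrite /line_set /= !mxE subrKC.
by exists (x + z); [rewrite /line_set /= mxE|rewrite addrC addKr].
Qed.

(** The rule decides membership of a point from what surrounds it within distance 3. *)
Lemma locally_derivable_rule S S' (rule : set R -> Prop) :
  (forall T T' : set R, (forall u, `|u| <= 3 -> (T u <-> T' u)) -> rule T -> rule T') ->
  (forall y, S' y <-> rule [set u | S (y + u)]) ->
  locally_derivable_from (line_set S') (line_set S).
Proof.
move=> loc S'E; exists (line_set `[- 3, 3]); first by apply: line_set_compact; exact: segment_compact.
suff key (x y : 'rV[R]_1) : translate (- x) (line_set S) `&` line_set `[- 3, 3] =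
    translate (- y) (line_set S) `&` line_set `[- 3, 3] ->
    translate (- x) (line_set S') `&` [set 0] `<=` translate (- y) (line_set S') `&` [set 0].
  by move=> x y xy; apply/seteqP; split; apply: key.
move=> xy w [wL /= w0]; rewrite {}w0 in wL *.
move: wL => /translateN_line_set; rewrite mxE addr0 => /S'E xr.
split => //; apply/translateN_line_set; rewrite mxE addr0; apply/S'E; apply: loc xr => u u3 /=.
have uI : line_set `[- 3, 3] (pt u) by rewrite line_set_pt /= in_itv /= -ler_norml.
have trE (z : 'rV[R]_1) : S (z ord0 ord0 + u) <->
    (translate (- z) (line_set S) `&` line_set `[- 3, 3]) (pt u).
  by split => [Su|[/translateN_line_set + _]]; [split => //; apply/translateN_line_set|]; rewrite ptE.
by rewrite !trE xy.
Qed.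

(** In two steps [2 z] decreases by at least 1, and by at most 1 in each step: its floor does
    decrease, and at the first step where it does, it does so by exactly 1. *)
Lemma window_runs a (z : R) : 4^-1 <= a -> a <= 2^-1 ->
  ~ (window (z - a) = window z /\ window (z - 2 * a) = window z).
Proof.
move=> a4 a2 [] ; rewrite /window.
have s1 : Num.floor (2 * z) <= Num.floor (2 * (z - a)) + 1.
  by rewrite -floorDz; apply: le_floor; rewrite /=; lra.
have s2 : Num.floor (2 * (z - a)) <= Num.floor (2 * (z - 2 * a)) + 1.
  by rewrite -floorDz; apply: le_floor; rewrite /=; lra.
have s3 : Num.floor (2 * (z - 2 * a)) <= Num.floor (2 * z) + -1.
  by rewrite -floorDz mulrNz; apply: le_floor; rewrite /=; lra.
have s4 : Num.floor (2 * (z - 2 * a)) <= Num.floor (2 * (z - a)) by apply: le_floor; lra.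
have s5 : Num.floor (2 * (z - a)) <= Num.floor (2 * z) by apply: le_floor; lra.
lia.
Qed.

Lemma site_int b a (k : int) : site b a 0 0 k%:~R <-> window (- (k%:~R * a)).
Proof.
split=> [[l [[kl]|[_ kl _]]]|wk]; last by exists k; left; rewrite add0r sub0r.
  by move: kl; rewrite add0r sub0r => /intr_inj ->.
have : (4 * k)%:~R = (4 * l + 1)%:~R :> R by rewrite intrD !intrM kl; field.
by move=> /intr_inj; lia.
Qed.

Lemma site_quarter a (k : int) :
  site true a 0 0 (k%:~R + 4^-1) <-> ~~ window (- (k%:~R * a)).
Proof.
split=> [[l [[kl _]|[_ kl]]]|wk]; last by exists k; right; rewrite add0r sub0r.
  have : (4 * k + 1)%:~R = (4 * l)%:~R :> R by rewrite intrD !intrM -[l%:~R]add0r -kl; field.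
  by move=> /intr_inj; lia.
by move: kl; rewrite add0r sub0r => /addIr/intr_inj ->.
Qed.

Lemma site_false_int a y : site false a 0 0 y -> exists k : int, y = k%:~R.
Proof. by move=> [k [[-> _]|[]//]]; exists k; rewrite add0r. Qed.

Lemma site_true_cases a y : site true a 0 0 y ->
  (exists k : int, y = k%:~R) \/ (exists k : int, y = k%:~R + 4^-1).
Proof. by move=> [k [[-> _]|[_ -> _]]]; [left|right]; exists k; rewrite add0r. Qed.

Lemma window_site_runs a (k : int) : 4^-1 <= a -> a <= 2^-1 ->
  ~ (window (- ((k + 1)%:~R * a)) = window (- (k%:~R * a)) /\
     window (- ((k + 2)%:~R * a)) = window (- (k%:~R * a))).
Proof.
move=> a4 a2; have := @window_runs a (- (k%:~R * a)) a4 a2.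
by rewrite !intrD !mulrDl mul1r !opprD.
Qed.

(** In the union a point has another one at distance 1/4, 5/4 or 9/4 ahead exactly when it is of
    the first kind, since one of any three consecutive cells is of the second kind. From the
    first set, [y - 1/4] is recognised as an integer by a point of the set in one of three
    consecutive cells, and then it is of the second kind if it is missing. *)
Lemma seed_MLD a : 4^-1 <= a -> a <= 2^-1 -> MLD_equivalent (seed false a) (seed true a).
Proof.
move=> a4 a2; split.
- apply: (@locally_derivable_rule _ _
    (fun T => T 0 /\ [\/ T 4^-1, T (5 / 4) | T (9 / 4)])).
    move=> T T' TT' [T0 T1]; split; first by apply/TT'; rewrite ?normr0//.
    by case: T1 => T1; [apply: Or31|apply: Or32|apply: Or33]; apply/TT' => //;
      rewrite ger0_norm; lra.
  move=> y /=; rewrite addr0; split.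
    move=> Sy; have [k yk] := site_false_int Sy; rewrite {}yk in Sy *.
    have wk := (site_int _ _ _).1 Sy; split; first exact/site_int.
    have [w1|w1] := boolP (window (- ((k + 1)%:~R * a))); last first.
      apply: Or32; have -> : k%:~R + 5 / 4 = (k + 1)%:~R + 4^-1 :> R by rewrite intrD; lra.
      exact/site_quarter.
    have [w2|w2] := boolP (window (- ((k + 2)%:~R * a))); last first.
      apply: Or33; have -> : k%:~R + 9 / 4 = (k + 2)%:~R + 4^-1 :> R by rewrite intrD; lra.
      exact/site_quarter.
    by have := @window_site_runs a k a4 a2; rewrite w1 w2 wk; case.
  move=> [Sy Sy']; case: (site_true_cases Sy) => -[k yk]; rewrite {}yk in Sy Sy' *.
    by apply/site_int; exact/(site_int true).
  have no (l : int) y' : y' = k%:~R + l%:~R + 2^-1 -> ~ site true a 0 0 y'.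
    move=> -> /site_true_cases[] [j jE].
      have : (2 * k + 2 * l + 1)%:~R = (2 * j)%:~R :> R by rewrite !intrD !intrM; lra.
      by move=> /intr_inj; lia.
    have : (4 * k + 4 * l + 2)%:~R = (4 * j + 1)%:~R :> R by rewrite !intrD !intrM; lra.
    by move=> /intr_inj; lia.
  exfalso; case: Sy'; [apply: (no 0)|apply: (no 1)|apply: (no 2)]; rewrite /=; lra.
- apply: (@locally_derivable_rule _ _
    (fun T => T 0 \/ (~ T (- 4^-1) /\ (T (3 / 4) \/ T (7 / 4))))).
    move=> T T' TT' [T0|[T1 T2]]; first by left; apply/TT'; rewrite ?normr0//.
    right; split; first by move=> T'1; apply: T1; apply/TT' => //; rewrite normrN ger0_norm; lra.
    by case: T2 => T2; [left|right]; apply/TT' => //; rewrite ger0_norm; lra.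
  move=> y /=; rewrite addr0; split.
    move=> Sy; case: (site_true_cases Sy) => -[k yk]; rewrite {}yk in Sy *.
      by left; apply/site_int; exact/(site_int true).
    have wk := (site_quarter _ _).1 Sy; right; rewrite addrK; split.
      by move=> /site_int wk'; rewrite wk' in wk.
    have -> : k%:~R + 4^-1 + 3 / 4 = (k + 1)%:~R :> R by rewrite intrD; lra.
    have -> : k%:~R + 4^-1 + 7 / 4 = (k + 2)%:~R :> R by rewrite intrD; lra.
    rewrite !site_int.
    have := @window_site_runs a k a4 a2; rewrite (negbTE wk).
    by case: (window _) => //; case: (window _) => //; [left|left|right|case].
  move=> [Sy|[nS Sy]].
    by have [k yk] := site_false_int Sy; rewrite yk in Sy *; apply/site_int/(site_int false).
  have [k yk] : exists k : int, y = k%:~R + 4^-1.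
    case: Sy => Sy; have [k yk] := site_false_int Sy.
      by exists (k - 1); rewrite intrB -yk; lra.
    by exists (k - 2); rewrite intrB -yk; lra.
  rewrite yk; apply/site_quarter/negP => wk; apply: nS.
  by rewrite yk addrK; exact/site_int.
Qed.

Definition complement_sites a : set 'rV[R]_1 := line_set
  [set y | exists2 k : int, y = k%:~R + 4^-1 & ~~ window (- (k%:~R * a))].

Lemma seed_union a : seed false a `|` complement_sites a = seed true a.
Proof.
apply/seteqP; split => x; rewrite /seed /complement_sites /line_set /=.
  move=> [[k [[xk w]|[]//]]|[k xk w]]; first by exists k; left.
  by have := (site_quarter a k).2 w; rewrite -xk.
move=> [k [[xk w]|[_ xk w]]]; first by left; exists k; left.
by right; exists k; rewrite ?xk ?add0r//; move: w; rewrite sub0r.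
Qed.

Lemma seed_disjoint a : seed false a `&` complement_sites a = set0.
Proof.
rewrite -subset0 => x; rewrite /seed /complement_sites /line_set /=.
move=> [/site_false_int[k ->] [l kl _]].
have : (4 * k)%:~R = (4 * l + 1)%:~R :> R by rewrite intrD !intrM kl; field.
by move=> /intr_inj; lia.
Qed.

Lemma finite_subsets (T : eqType) (l : seq T) : finite_set [set A : set T | A `<=` [set` l]].
Proof.
apply: (@sub_finite_set _ _ [set [set` mask m l] | m in [set: (size l).-tuple bool]]).
  move=> A Al; exists (map_tuple (fun x => `[< A x >]) (in_tuple l)) => //.
  rewrite /= -filter_mask; apply/seteqP; split => x /=.
    by rewrite mem_filter => /andP[/asboolP].
  by move=> Ax; rewrite mem_filter; apply/andP; split; [exact/asboolP|exact: Al].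
exact/finite_image/finite_finset.
Qed.

(** Seen from any of its points, the set lies in the same grid, which has finitely many points in
    a compact set. *)
Lemma FLC_quarter S : (forall y, S y -> exists j : int, y = j%:~R / 4) -> FLC (line_set S).
Proof.
move=> Sq.
pose grid (B : nat) : seq 'rV[R]_1 := [seq pt ((k%:Z - (4 * B)%N%:Z)%:~R / 4) | k <- iota 0 (8 * B).+1].
have gridP (B : nat) (j : int) : `|j%:~R / 4 : R| <= B%:R -> pt (j%:~R / 4) \in grid B.
  move=> jB; have [j1 j2] : - (4 * B)%N%:Z <= j /\ j <= (4 * B)%N%:Z.
    move: jB; rewrite ler_norml => /andP[j1 j2]; rewrite -!(ler_int R) mulrNz -pmulrn natrM.
    by split; lra.
  apply/mapP; exists (absz (j + (4 * B)%N%:Z)); last by rewrite gez0_abs ?addrK//; lia.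
  by rewrite mem_iota; lia.
split=> K cK; have [B BK] := compact_coord_bounded cK.
  apply: (@sub_finite_set _ _ [set` grid B]); last exact: finite_seq.
  move=> x [/Sq[j xj] Kx] /=; rewrite -(ptK x) xj; apply: gridP; rewrite -xj; apply: BK.
  by rewrite ptK.
apply: (sub_finite_set _ (finite_subsets (grid B))) => _ [x Sx <-] z [/translateN_line_set Sz Kz] /=.
have [j xj] := Sq _ Sx; have [i zi] := Sq _ Sz.
have zE : z ord0 ord0 = (i - j)%:~R / 4.
  by move: zi; rewrite xj => /(canRL (addKr _)) ->; rewrite intrB; field.
rewrite -(ptK z) zE; apply: gridP; rewrite -zE; apply: BK; by rewrite ptK.
Qed.

Lemma seed_FLC a : FLC (seed false a).
Proof.
apply: FLC_quarter => y /site_false_int[k ->]; exists (4 * k).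
by rewrite intrM; field.
Qed.

Lemma complement_FLC a : FLC (complement_sites a).
Proof.
apply: FLC_quarter => y [k -> _]; exists (4 * k + 1).
by rewrite intrD intrM; field.
Qed.

End LocalDerivability.

(** * The theorem *)

Unset Implicit Arguments.

Theorem theorem2 (R : realType) :
  exists (d : nat) (L1 L2 : set 'rV[R]_d),
    (0 < d)%N /\
    FLC L1 /\ FLC L2 /\ L1 `&` L2 = set0 /\
    MLD_equivalent L1 (L1 `|` L2) /\
    (exists P : point_process_law R d,
       associated_point_process L1 P /\
       locally_square_integrable P /\ ~ hyperuniform P) /\
    (exists P : point_process_law R d,
       associated_point_process (L1 `|` L2) P /\
       locally_square_integrable P /\ hyperuniform P).
Proof.
have [a [a4 a2 la]] := @exists_liouville R.
exists 1%N, (seed false a), (complement_sites a); rewrite seed_union.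
split; first by [].
split; first exact: seed_FLC.
split; first exact: complement_FLC.
split; first exact: seed_disjoint.
split; first exact: seed_MLD.
split; [exists (law false a)|exists (law true a)].
- split; [exact: law_associated|split; [exact: law_square_integrable|exact: seed_not_hyperuniform]].
- split; [exact: law_associated|split; [exact: law_square_integrable|exact: union_hyperuniform]].
Qed.
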